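(* Suppose $\phi'(1)=1$ and that there exist $\alpha\in(0,1)$ and $c>0$ such that $$\lim_{s\to1-}\frac{1-s\phi'(h(s))}{(1-s)^\alpha}=c.$$ Let $\{c_n\}$ be a sequence of positive numbers such that $c_n\to+\infty$ and $c_n=o(n)$ as $n\to\infty$. (1) If the random walk $S$ is right continuous with $\phi$, then for any $x>0$, $$\lim_{n\to+\infty}\frac1{c_n}\ln\mathbb{P}\left(A_n\ge x\,n^{1-\alpha}c_n^{\alpha}\right)=-\frac{\alpha}{1-\alpha}\left(\frac qc\right)^{1/\alpha}x^{1/\alpha}.$$ (2) If the random walk $S$ is left continuous with $\phi$, then for any $x>0$, $$\lim_{n\to+\infty}\frac1{c_n}\ln\mathbb{P}\left(A_n\ge x\,n^{\alpha}c_n^{1-\alpha}\right)=-\left[c(1-\alpha)^{2-\alpha}\alpha^{\alpha}\right]^{1/(1-\alpha)}x^{1/(1-\alpha)}.$$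
   Context: Let $X_1,X_2,\dots$ be i.i.d. integer-valued random variables, $S_0=0$, $S_n=\sum_{i=1}^nX_i$ for $n\ge1$, and $M_n=\max_{0\le m\le n}S_m$ for $n\ge0$. Let $T_0=0$ and $T_n=\inf\{m>T_{n-1}: S_m\ge M_{m-1}\}$ for $n\ge1$ (with $\inf\emptyset=+\infty$), and let $A_n=\sup\{k\ge1: T_k\le n\}$ for $n\ge1$ (with $\sup\emptyset=0$). $A_n$ is the weak record number up to time $n$. Let $q>0$ and $p_n\ge0$ ($n\ge0$) with $q+\sum_{n\ge0}p_n=1$, and let $\phi(s)=q+\sum_{n=0}^\infty p_ns^{n+1}$, $s\in[0,1]$; $\phi'(1)$ denotes the left derivative at $1$. $S$ is right continuous with $\phi$ if $\mathbb{P}(X_i=1)=q$ and $\mathbb{P}(X_i=-n)=p_n$ for all $n\ge0$. $S$ is left continuous with $\phi$ if $\mathbb{P}(X_i=-1)=q$ and $\mathbb{P}(X_i=n)=p_n$ for all $n\ge0$. For $s\in[0,1]$, $h(s)$ denotes the minimal non-negative solution $x\in[0,1]$ of $x=s\phi(x)$. *)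

(* Defs.v *)
From HB Require Import structures.
From mathcomp Require Export all_boot all_order all_algebra.
From mathcomp Require Export finmap.
From mathcomp Require Export all_classical all_reals all_analysis.

Set Implicit Arguments.
Unset Strict Implicit.
Unset Printing Implicit Defensive.

Import Order.TTheory GRing.Theory Num.Theory.
Import numFieldNormedType.Exports.

Local Open Scope classical_set_scope.
Local Open Scope ring_scope.

HB.instance Definition _ := isPointed.Build int 0.
HB.instance Definition _ := @isMeasurable.Build default_measure_display
  int discrete_measurable discrete_measurable0
  discrete_measurableC discrete_measurableU.

Section iid.
Context d d' (T : measurableType d) (E : measurableType d') (R : realType).
Context (P : probability T R).
Implicit Type X : nat -> {RV P >-> E}.

Definition mutually_independent X :=
  forall (J : {fset nat}) (B : nat -> set E),
    (forall i, i \in J -> measurable (B i)) ->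
    P (\bigcap_(i in [set` J]) (X i @^-1` B i)) =
      (\prod_(i <- J) P (X i @^-1` B i))%E.

Definition identically_distributed X :=
  forall i j (B : set E), measurable B ->
    distribution P (X i) B = distribution P (X j) B.

Definition iid X := mutually_independent X /\ identically_distributed X.

End iid.

Section walk.
Context d (T : measurableType d) (R : realType) (P : probability T R).
Implicit Types (X : nat -> {RV P >-> int}) (s : nat -> int) (p : nat -> R).

(* The increments are indexed from 0: X i is the (i+1)-st step of the walk. *)
Definition walk X (w : T) (n : nat) : int := \sum_(i < n) X i w.

Definition running_max s (n : nat) : int := \big[Num.max/s 0%N]_(m < n.+1) s m.

(* [m.-1] is only used for [m > 0], since the record times are nonnegative. *)
Fixpoint record_time s (k : nat) : \bar R :=
  if k isn't k'.+1 then 0%E else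
  ereal_inf [set (m%:R : R)%:E | m in
    [set m | (record_time s k' < (m%:R : R)%:E)%E /\ running_max s m.-1 <= s m]].

(* The real [sup] satisfies [sup set0 = 0]. *)
Definition weak_record_number s (n : nat) : R :=
  sup [set (k%:R : R) | k in
    [set k | (1 <= k)%N /\ (record_time s k <= (n%:R : R)%:E)%E]].

Definition right_continuous_walk (q : R) p X :=
  forall i, P (X i @^-1` [set 1]) = q%:E /\
    forall n : nat, P (X i @^-1` [set - n%:Z]) = (p n)%:E.

Definition left_continuous_walk (q : R) p X :=
  forall i, P (X i @^-1` [set -1]) = q%:E /\
    forall n : nat, P (X i @^-1` [set n%:Z]) = (p n)%:E.

End walk.

Section generating_function.
Context (R : realType).
Implicit Types (q s x : R) (p : nat -> R) (f : R -> R).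

Definition phi q p s : R := q + limn (series (fun n => p n * s ^+ n.+1)).

Definition is_left_derivative f x (l : R) :=
  (f y - f x) / (y - x) @[y --> x^'-] --> l.

Definition is_minimal_solution q p s x :=
  [/\ 0 <= x <= 1, x = s * phi q p x &
    forall y, 0 <= y <= 1 -> y = s * phi q p y -> x <= y].

(* For [s] in [0, 1] a minimal solution exists and is unique, so the default value
   0 of [xget] is not used. *)
Definition minimal_solution q p s : R := xget 0 (is_minimal_solution q p s).

End generating_function.

(* Main.v *)
Require Import Defs.
From mathcomp Require Import ring lra zify.

Set Implicit Arguments.
Unset Strict Implicit.
Unset Printing Implicit Defensive.

Import Order.TTheory GRing.Theory Num.Theory.
Import numFieldNormedType.Exports.

Local Open Scope classical_set_scope.
Local Open Scope ring_scope.

(** Write y = M_n - S_n for the depth of the walk below its running maximum.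
    The depth is a Markov chain on nat: a step of size z from depth y produces
    a weak record exactly when y <= z, and then the depth becomes 0, otherwise
    it becomes y - z. Records are thus renewals: the k-th record time has
    generating function E[s^{T_k}] = f(s)^k, and A_n >= k iff T_k <= n.

    The function f is computed from the minimal solution h = h(s) of
    x = s phi(x). When the walk goes up by at most one, h is the generating
    function of the time needed to climb one level, and decomposing on the
    first step gives 1 - f(s) = s q (1 - h) / h. When the walk goes down by at
    most one, summing the first-step equation over all starting depths y
    against h^y (the kernel method) cancels every unknown except f and gives
    1 - f(s) = (1 - s) / (1 - h).

    The minimal solution is the inverse of g(x) = x / phi(x), and in terms of
    g the assumption says that the derivative of (1 - g)^{1-a} tends to
    -c (1 - a) at 1. By de l'Hopital's rule (1 - s)^{1-a} / (1 - h(s)) tends to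
    c (1 - a). Hence 1 - f(s) ~ C (1 - s)^b with b = 1 - a, C = q / (c (1 - a))
    for the first walk, and with b = a, C = c (1 - a) for the second one.

    It remains to treat a renewal sequence with such an f. For
    k = x n^b c_n^{1-b} the exponent log E[exp(- th (c_n / n) T_k)] / c_n
    tends to - x C th^b for every th > 0, and P(T_k <= n) is then obtained as in
    the Gartner-Ellis theorem: Markov's inequality gives the upper bound, and
    the lower bound follows because, in the geometric average that represents
    the Laplace transform, all times outside [rho n, n] carry an exponentially
    smaller mass than the total, the two outer parts being estimated by the
    same average with a slightly larger and a slightly smaller th. The
    optimal th is (x C b)^{1/(1-b)}, which yields the rate
    (x C b)^{1/(1-b)} (1 - b) / b. *)

(** * Averages against a probability weight on nat *)

Section mean.
Context (R : realType).
Implicit Types (w : nat -> R) (F G : nat -> \bar R).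
Local Open Scope ereal_scope.

Definition is_weight w :=
  (forall j, (0 <= w j)%R) /\ \sum_(0 <= j <oo) (w j)%:E = 1.

Definition mean w F : \bar R := \sum_(0 <= j <oo) (w j)%:E * F j.

Lemma mean_ge0 w F : is_weight w -> (forall j, 0 <= F j) -> 0 <= mean w F.
Proof.
by move=> [w0 _] F0; apply: nneseries_ge0 => j _ _; rewrite mule_ge0// lee_fin.
Qed.

Lemma le_mean w F G : is_weight w -> (forall j, 0 <= F j) ->
  (forall j, F j <= G j) -> mean w F <= mean w G.
Proof.
move=> [w0 _] F0 FG; apply: lee_nneseries => [j _ _|j _].
  by rewrite mule_ge0// lee_fin.
by rewrite lee_wpmul2l// lee_fin.
Qed.

Lemma eq_mean w F G : F =1 G -> mean w F = mean w G.
Proof. by move=> /funext ->. Qed.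

Lemma mean_cst w (r : R) : is_weight w -> (0 <= r)%R ->
  mean w (cst r%:E) = r%:E.
Proof.
move=> [w0 w1] r0; rewrite /mean /=.
under eq_eseriesr do rewrite muleC.
by rewrite nneseriesZl ?w1 ?mule1// => j _; rewrite lee_fin.
Qed.

Lemma meanD w F G : is_weight w -> (forall j, 0 <= F j) ->
  (forall j, 0 <= G j) -> mean w (F \+ G) = mean w F + mean w G.
Proof.
move=> [w0 _] F0 G0; rewrite /mean -nneseriesD.
- by apply: eq_eseriesr => j _; rewrite ge0_muleDr.
- by move=> j _ _; rewrite mule_ge0// lee_fin.
- by move=> j _ _; rewrite mule_ge0// lee_fin.
Qed.

Lemma meanZ w F (r : R) : is_weight w -> (forall j, 0 <= F j) ->
  mean w (fun j => r%:E * F j) = r%:E * mean w F.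
Proof.
move=> [w0 _] F0; rewrite /mean -nneseriesZl.
  by apply: eq_eseriesr => j _; rewrite muleCA.
by move=> j _; rewrite mule_ge0// lee_fin.
Qed.

Lemma mean_swap v w (F : nat -> nat -> \bar R) : is_weight v -> is_weight w ->
  (forall i j, 0 <= F i j) ->
  mean v (fun i => mean w (F i)) = mean w (fun j => mean v (F ^~ j)).
Proof.
move=> [v0 _] [w0 _] F0; rewrite /mean.
transitivity (\sum_(0 <= i <oo) \sum_(0 <= j <oo)
    ((v i)%:E * ((w j)%:E * F i j))).
  apply: eq_eseriesr => i _; rewrite nneseriesZl// => j _.
  by rewrite mule_ge0// lee_fin.
rewrite nneseries_interchange; last first.
  by move=> i j; rewrite !mule_ge0// lee_fin.
apply: eq_eseriesr => j _; rewrite -nneseriesZl.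
  by apply: eq_eseriesr => i _; rewrite muleCA.
by move=> i _; rewrite mule_ge0// lee_fin.
Qed.

Lemma mean_le1 w F : is_weight w -> (forall j, 0 <= F j) ->
  (forall j, F j <= 1) -> mean w F <= 1.
Proof.
by move=> ww F0 F1; rewrite (le_trans (@le_mean w F (cst 1) ww F0 F1))// mean_cst.
Qed.

Lemma mean_recl w F : is_weight w -> (forall j, 0 <= F j) ->
  mean w F = (w 0%N)%:E * F 0%N + \sum_(0 <= j <oo) (w j.+1)%:E * F j.+1.
Proof.
move=> [w0 _] F0.
have wF j : 0 <= (w j)%:E * F j by rewrite mule_ge0// lee_fin.
rewrite /mean nneseries_recl//; congr +%E.
rewrite -(@nneseries_addn _ (fun j => (w j)%:E * F j) 1)//.
by apply: eq_eseriesr => j _; rewrite addn1.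
Qed.

(** The law of a geometric killing time: averaging P(T <= n) against it
    yields the generating function E[s^T] itself, without the factor 1 / (1 - s). *)
Definition geom (s : R) (n : nat) : R := ((1 - s) * s ^+ n)%R.

Lemma geom_weight s : (0 <= s < 1)%R -> is_weight (geom s).
Proof.
move=> /andP[s0 s1]; split=> [j|].
  by rewrite mulr_ge0 ?exprn_ge0 ?subr_ge0// ltW.
apply/cvg_lim => //.
rewrite (_ : (fun n => _) =
    (EFin \o series (geometric (1 - s)%R s))); last first.
  by apply/funext => n /=; rewrite /series /= sumEFin.
apply: cvg_EFin; first exact: nearW.
rewrite -[X in _ --> X](@mulfV _ (1 - s)%R) ?subr_eq0 ?gt_eqF//.
by apply: cvg_geometric_series; rewrite ger0_norm.
Qed.

Lemma mean_geomS s F : (0 <= s < 1)%R -> (forall j, 0 <= F j) ->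
  mean (geom s) F = (1 - s)%:E * F 0%N + s%:E * mean (geom s) (fun n => F n.+1).
Proof.
move=> s01 F0; rewrite mean_recl//; last exact: geom_weight.
rewrite /geom expr0 mulr1; congr +%E; rewrite /mean -nneseriesZl.
  by apply: eq_eseriesr => j _; rewrite exprS mulrCA EFinM muleA.
move=> j _; rewrite mule_ge0// lee_fin.
by have [+ _] := geom_weight s01; apply.
Qed.

(** Lack of memory of the geometric law. *)
Lemma mean_geom_shift s F N : (0 <= s < 1)%R -> (forall j, 0 <= F j) ->
  mean (geom s) (fun n => if (n < N)%N then 1 else F (n - N)%N)
  = (1 - s ^+ N)%:E + (s ^+ N)%:E * mean (geom s) F.
Proof.
move=> s01 F0; have ws := geom_weight s01; case/andP: (s01) => s0 s1.
have m0 : 0 <= mean (geom s) F by exact: mean_ge0.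
elim: N => [|N IH].
  rewrite expr0 subrr add0e mul1e; apply: eq_mean => n.
  by rewrite ltn0 subn0.
rewrite mean_geomS//; last by move=> j; case: ifP.
rewrite /= mule1 (@eq_mean _ _ (fun n => if (n < N)%N then 1 else F (n - N)%N)).
  rewrite IH ge0_muleDr//.
  - rewrite muleA addeA -!EFinM -exprS -EFinD; congr (_%:E + _).
    by rewrite mulrBr mulr1 exprS; ring.
  - by rewrite lee_fin subr_ge0 exprn_ile1// ltW.
  - by rewrite mule_ge0// lee_fin exprn_ge0.
by move=> n; rewrite ltnS subSS.
Qed.

End mean.

(** * Limits of real functions *)

Section limits.
Context (R : realType).

Lemma cvg_to_at_left {I : Type} {F : set_system I} {FF : Filter F}
    (u : I -> R) (a : R) :
  u i @[i --> F] --> a -> (\forall i \near F, u i < a) ->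
  u i @[i --> F] --> a^'-.
Proof. by move=> ua ult P Pa; apply: filterS2 (ua _ Pa) ult => i; apply. Qed.

Lemma cvg_to_at_right {I : Type} {F : set_system I} {FF : Filter F}
    (u : I -> R) (a : R) :
  u i @[i --> F] --> a -> (\forall i \near F, a < u i) ->
  u i @[i --> F] --> a^'+.
Proof. by move=> ua ult P Pa; apply: filterS2 (ua _ Pa) ult => i; apply. Qed.

Lemma cvg_near_eq {I : Type} {F : set_system I} {FF : Filter F}
    (u v : I -> R) (l : R) : (\forall i \near F, u i = v i) ->
  u i @[i --> F] --> l -> v i @[i --> F] --> l.
Proof.
move=> uv ul; apply: cvg_trans ul => P /= uP.
by apply: filterS2 uv uP => i /= <-.
Qed.

Lemma cvg_powR {I : Type} {F : set_system I} {FF : Filter F}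
    (u : I -> R) (a b : R) : 0 < a -> u i @[i --> F] --> a ->
  u i `^ b @[i --> F] --> a `^ b.
Proof.
move=> a0 ua; apply: (@cvg_comp _ _ _ u (fun t => t `^ b) _ _ _ ua).
suff : {for a, continuous (fun t : R => t `^ b)} by [].
apply/differentiable_continuous/derivable1_diffP.
by apply: derivable_powR; rewrite in_itv/= andbT.
Qed.

Lemma oneBexpRN_bounds (t : R) : t * expR (- t) <= 1 - expR (- t) <= t.
Proof.
have e0 := expR_gt0 (- t); have := expR_ge1Dx (- t) => h1.
have h2 := expR_ge1Dx t.
have h3 : (1 + t) * expR (- t) <= 1.
  by have := ler_wpM2r (ltW e0) h2; rewrite expRxMexpNx_1.
by apply/andP; split; lra.
Qed.

Lemma cvg_ln_slope {I : Type} {F : set_system I} {FF : Filter F} (y : I -> R) :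
  y i @[i --> F] --> (1 : R) -> (\forall i \near F, y i < 1) ->
  ln (y i) / (1 - y i) @[i --> F] --> (-1 : R).
Proof.
move=> y1 ylt.
have yV : - (y i)^-1 @[i --> F] --> (-1 : R).
  by apply: cvgN; rewrite -[X in _ --> X]invr1; apply: cvgV.
apply: (squeeze_cvgr _ yV (cvg_cst (-1 : R))).
near=> i.
have y0 : 0 < y i by near: i; apply: (cvgr_gt (1 : R)).
have yl : y i < 1 by near: i.
have y1' : 0 < 1 - y i by rewrite subr_gt0.
have u : ln (y i) <= y i - 1.
  have := @le_ln1Dx R (y i - 1); rewrite addrCA subrr addr0; apply; lra.
have l : 1 - (y i)^-1 <= ln (y i).
  have := @le_ln1Dx R ((y i)^-1 - 1); rewrite addrCA subrr addr0.
  rewrite lnV ?posrE// => h; have : -1 < (y i)^-1 - 1.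
    by rewrite ltrBrDl subrr invr_gt0.
  by move=> /h; lra.
rewrite ler_pdivrMr// ler_pdivlMr//.
apply/andP; split; last lra.
by apply: le_trans l; rewrite mulrBr mulr1 mulNr mulVf ?gt_eqF//; lra.
Unshelve. all: end_near. Qed.

End limits.

(** * The Markov chain of the depth below the running maximum *)

Section record_chain.
Context (R : realType) (w : nat -> R) (hw : is_weight w).
Context (step : nat -> nat -> option nat).
Local Open Scope ereal_scope.

(** The probability of at least k records among the next n steps, from
    depth y. The value None of step y j stands for a record, after which the
    depth is 0. *)
Fixpoint record_prob (n k y : nat) : \bar R :=
  match k, n with
  | 0%N, _ => 1
  | _.+1, 0%N => 0
  | k'.+1, n'.+1 => mean w (fun j =>
      if step y j is Some y' then record_prob n' k y' else record_prob n' k' 0)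
  end.

Lemma record_prob0 n y : record_prob n 0 y = 1.
Proof. by case: n. Qed.

Lemma record_prob_ge0 n k y : 0 <= record_prob n k y.
Proof.
elim: n k y => [|n IH] [|k] y //=.
by apply: mean_ge0 => // j; case: (step y j).
Qed.
Hint Resolve record_prob_ge0 : core.

Lemma record_prob_le1 n k y : record_prob n k y <= 1.
Proof.
elim: n k y => [|n IH] [|k] y //=.
by apply: mean_le1 => // j; case: (step y j).
Qed.
Hint Resolve record_prob_le1 : core.

Lemma record_probS n k y : record_prob n k y <= record_prob n.+1 k y.
Proof.
elim: n k y => [|n IH] [|k] y //; first exact: record_prob_ge0.
by apply: le_mean => // j; case: (step y j).
Qed.

Lemma record_prob_nd k y :
  {homo (fun n => record_prob n k y) : m n / (m <= n)%N >-> m <= n}.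
Proof.
by apply: homo_leq => // [? ? ?|n]; [exact: le_trans|exact: record_probS].
Qed.

Lemma record_prob_fin n k y : record_prob n k y \is a fin_num.
Proof.
rewrite ge0_fin_numE ?record_prob_ge0//.
exact: le_lt_trans (record_prob_le1 _ _ _) (ltry 1).
Qed.

Section generating_function.
Context (s : R) (s01 : (0 <= s < 1)%R).
Let ws : is_weight (geom s) := geom_weight s01.
Let s0 : (0 <= s)%R. Proof. by case/andP: s01. Qed.

Definition record_gf k y : \bar R := mean (geom s) (fun n => record_prob n k y).

Lemma record_gf_ge0 k y : 0 <= record_gf k y.
Proof. by apply: mean_ge0. Qed.
Hint Resolve record_gf_ge0 : core.

Lemma record_gf_le1 k y : record_gf k y <= 1.
Proof. by apply: mean_le1. Qed.

Lemma record_gf_fin k y : record_gf k y \is a fin_num.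
Proof.
rewrite ge0_fin_numE ?record_gf_ge0//.
exact: le_lt_trans (record_gf_le1 _ _) (ltry 1).
Qed.

Lemma record_gf0 y : record_gf 0 y = 1.
Proof.
rewrite -(mean_cst ws ler01) /record_gf; apply: eq_mean => n /=.
exact: record_prob0.
Qed.

(** The first step takes one unit of time, whence the factor s; it leads
    either to a new depth or to a record. *)
Lemma record_gfS k y : record_gf k.+1 y =
  s%:E * mean w (fun j =>
    if step y j is Some y' then record_gf k.+1 y' else record_gf k 0).
Proof.
rewrite {1}/record_gf mean_geomS// mule0 add0e; congr *%E.
rewrite (mean_swap ws hw); last by move=> i j; case: (step y j).
by apply: eq_mean => j; case: (step y j).
Qed.

(** The equation contracts by the factor s, so that v <= v' + s^m
    follows for every m by induction, starting from v <= 1. *)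
Lemma chain_comparison (c : \bar R) (v v' : nat -> \bar R) :
  (forall y, 0 <= v y <= 1) -> (forall y, 0 <= v' y) -> 0 <= c ->
  (forall y, v y = s%:E * mean w (fun j =>
    if step y j is Some y' then v y' else c)) ->
  (forall y, v' y = s%:E * mean w (fun j =>
    if step y j is Some y' then v' y' else c)) ->
  forall y, v y <= v' y.
Proof.
move=> v01 v'0 c0 vE v'E.
have v0 y : 0 <= v y by case/andP: (v01 y).
have sn0 m : (0 <= s ^+ m)%R by rewrite exprn_ge0.
have claim m y : v y <= v' y + (s ^+ m)%:E.
  elim: m y => [|m IH] y.
    by rewrite expr0 (le_trans (andP (v01 y)).2)// leeDr.
  rewrite vE v'E exprS EFinM -ge0_muleDr//; last first.
  - by rewrite lee_fin.
  - by apply: mean_ge0 => // j; case: (step y j).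
  apply: lee_wpmul2l; first by rewrite lee_fin.
  rewrite -(mean_cst hw (sn0 m)) -meanD//; last first.
  - by move=> j; rewrite lee_fin.
  - by move=> j; case: (step y j).
  apply: le_mean => // [j|j /=]; first by case: (step y j).
  by case: (step y j) => [y'|]; [exact: IH|rewrite leeDl// lee_fin].
move=> y.
have := v'0 y; case E : (v' y) => [r| |] // _; last by rewrite leey.
have vfin : v y \is a fin_num.
  rewrite ge0_fin_numE//.
  by rewrite (le_lt_trans (andP (v01 y)).2)// ltry.
rewrite -(fineK vfin) lee_fin.
have sm : (r + s ^+ m)%R @[m --> \oo] --> (r + 0)%R.
  apply: cvgD; first exact: cvg_cst.
  by apply: cvg_expr; rewrite ger0_norm//; case/andP: s01.
rewrite addr0 in sm.
rewrite -(cvg_lim _ sm)//; apply: limr_ge; first exact: cvgP sm.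
apply: nearW => m; rewrite -lee_fin (fineK vfin) EFinD -E.
exact: claim.
Qed.

Lemma chain_uniqueness (c : \bar R) (v v' : nat -> \bar R) :
  (forall y, 0 <= v y <= 1) -> (forall y, 0 <= v' y <= 1) -> 0 <= c ->
  (forall y, v y = s%:E * mean w (fun j =>
    if step y j is Some y' then v y' else c)) ->
  (forall y, v' y = s%:E * mean w (fun j =>
    if step y j is Some y' then v' y' else c)) ->
  v =1 v'.
Proof.
move=> v01 v'01 c0 vE v'E y; apply/eqP; rewrite eq_le; apply/andP.
by split; apply: (chain_comparison _ _ c0) => // z;
  [case/andP: (v'01 z)|case/andP: (v01 z)].
Qed.

Lemma record_gf1_unique (v : nat -> \bar R) : (forall y, 0 <= v y <= 1) ->
  (forall y, v y = s%:E * mean w (fun j =>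
    if step y j is Some y' then v y' else 1)) ->
  record_gf 1 =1 v.
Proof.
move=> v01 vE; apply: (@chain_uniqueness 1) => // y.
  by rewrite record_gf_ge0 record_gf_le1.
by rewrite record_gfS record_gf0.
Qed.

(** The renewal property. The functions record_gf k.+1 and
    f^k record_gf 1 of the depth solve the same first-step equation, hence
    coincide. *)
Lemma record_gf_pow k : record_gf k 0 = (fine (record_gf 1 0) ^+ k)%:E.
Proof.
set f := fine _.
have fE : record_gf 1 0 = f%:E by rewrite fineK// record_gf_fin.
have f0 : (0 <= f)%R by rewrite -lee_fin -fE.
have f1 : (f <= 1)%R by rewrite -lee_fin -fE record_gf_le1.
elim: k => [|k IH]; first by rewrite record_gf0.
have fk0 : (0 <= f ^+ k)%R by rewrite exprn_ge0.
suff -> : record_gf k.+1 0 = (f ^+ k)%:E * record_gf 1 0.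
  by rewrite fE -EFinM -exprSr.
apply: (@chain_uniqueness (f ^+ k)%:E _ (fun y => (f ^+ k)%:E * record_gf 1 y)).
- by move=> y; rewrite record_gf_ge0 record_gf_le1.
- move=> y; apply/andP; split; first by rewrite mule_ge0 ?lee_fin.
  rewrite -[leRHS]mule1; apply: lee_pmul; rewrite ?lee_fin ?record_gf_le1//.
  exact: exprn_ile1.
- by rewrite lee_fin.
- by move=> y; rewrite record_gfS IH.
- move=> y; rewrite record_gfS muleCA -(meanZ (f ^+ k))//; last first.
    by move=> j; case: (step y j).
  congr *%E; apply: eq_mean => j.
  by case: (step y j) => [//|]; rewrite record_gf0 mule1.
Qed.

End generating_function.
End record_chain.

Section first_record.
Context (R : realType) (w : nat -> R) (hw : is_weight w).
Context (s h : R) (s01 : 0 < s < 1) (h01 : 0 < h < 1).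
Hypothesis hE : (h%:E = s%:E * mean w (fun j => (h ^+ j)%:E))%E.
Let s0 : 0 < s. Proof. by case/andP: s01. Qed.
Let s1 : s < 1. Proof. by case/andP: s01. Qed.
Let h0 : 0 < h. Proof. by case/andP: h01. Qed.
Let h1 : h < 1. Proof. by case/andP: h01. Qed.
Let s01' : 0 <= s < 1. Proof. by rewrite ltW. Qed.
Let h01' : 0 <= h < 1. Proof. by rewrite ltW. Qed.
Let hn0 n : 0 <= h ^+ n. Proof. by rewrite exprn_ge0// ltW. Qed.
Let hn1 n : h ^+ n <= 1. Proof. by rewrite exprn_ile1 // ltW. Qed.

Definition right_step (y j : nat) : option nat :=
  if (y + j <= 1)%N then None else Some (y + j).-1.

Definition left_step (y j : nat) : option nat :=
  if (y < j)%N then None else Some (y.+1 - j)%N.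

(** Starting from depth y > 0, a record means climbing y levels, which
    suggests h^y for the generating function. This guess satisfies the
    first-step equation, whose bounded solution is unique. *)
Lemma right_first_record_gf :
  record_gf w right_step s 1 0 = (1 - s * w 0%N * (1 - h) / h)%:E.
Proof.
pose m := mean w (fun j => (h ^+ j.-1)%:E).
have m0 : (0 <= m)%E by apply: mean_ge0 => // j; rewrite lee_fin.
have m1 : (m <= 1)%E by apply: mean_le1 => // j; rewrite lee_fin.
pose v y := (if y == 0%N then s%:E * m else (h ^+ y)%:E)%E.
have v01 y : (0 <= v y <= 1)%E.
  rewrite /v; case: eqP => _; last by rewrite !lee_fin hn0 hn1.
  rewrite mule_ge0 ?lee_fin ?(ltW s0)//=.
  by rewrite -[leRHS]mule1 lee_pmul// lee_fin ltW.
rewrite (@record_gf1_unique _ _ hw _ _ s01' v) //; last first.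
  move=> y; rewrite {1}/v; case: eqP => [->|/eqP y0].
    congr *%E; apply: eq_mean => j; rewrite /right_step add0n.
    by case: j => [|[|j]].
  transitivity (h%:E * (h ^+ y.-1)%:E)%E.
    by rewrite -EFinM -exprS prednK// lt0n.
  rewrite hE -muleA; congr *%E.
  rewrite muleC -meanZ //; apply: eq_mean => j.
  rewrite -EFinM -exprD /right_step /v; case: y y0 => // y _.
  rewrite !addSn /= ltnS; case: leqP; last by rewrite lt0n => /negbTE ->.
  by rewrite leqn0 => /eqP ->; rewrite expr0.
rewrite /v eqxx.
pose S := (\sum_(0 <= j <oo) (w j.+1)%:E * (h ^+ j)%:E)%E.
have w0 j : 0 <= w j by case: hw.
have S0 : (0 <= S)%E by apply: nneseries_ge0 => j _ _; rewrite mule_ge0 ?lee_fin.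
have mE : m = ((w 0%N)%:E + S)%E.
  by rewrite /m mean_recl ?expr0 ?mule1// => j; rewrite lee_fin.
have Sfin : S \is a fin_num.
  rewrite ge0_fin_numE//; apply: le_lt_trans (ltry 1); apply: le_trans m1.
  by rewrite mE leeDr// lee_fin.
have hE1 : (h%:E = s%:E * ((w 0%N)%:E + h%:E * S))%E.
  rewrite [LHS]hE mean_recl//.
  rewrite expr0 mule1; congr (_ * (_ + _))%E.
  rewrite /S -nneseriesZl; last by move=> j _; rewrite mule_ge0 ?lee_fin.
  by apply: eq_eseriesr => j _; rewrite exprS EFinM muleCA.
move: hE1; rewrite mE -(fineK Sfin); move: (fine S) => r.
rewrite -(EFinM h) -!EFinD -!EFinM => -[hE2]; congr EFin.
have h_neq0 : h != 0 by rewrite gt_eqF.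
apply: (mulfI h_neq0).
have -> : h * (1 - s * w 0%N * (1 - h) / h) = h - s * w 0%N * (1 - h) by field.
by move: hE2; lra.
Qed.

(** The kernel method. Let v y be the generating function from depth y and
    average the first-step equation over y with weights (1 - h) h^y. By lack of
    memory the right-hand side only involves the average m of v y.+1, with
    coefficient s phi(h) = h. The left-hand side is (1 - h) v 0 + h m, so m
    cancels. *)
Lemma left_first_record_gf :
  record_gf w left_step s 1 0 = ((s - h) / (1 - h))%:E.
Proof.
pose v y := record_gf w left_step s 1 y.
have v0 y : (0 <= v y)%E by exact: record_gf_ge0.
have v1 y : (v y <= 1)%E by exact: record_gf_le1.
have vfin y : v y \is a fin_num by exact: record_gf_fin.
have wh := geom_weight h01'.
pose m := mean (geom h) (fun y => v y.+1).
have m0 : (0 <= m)%E by exact: mean_ge0.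
have mfin : m \is a fin_num.
  by rewrite ge0_fin_numE//; apply: le_lt_trans (ltry 1); exact: mean_le1.
have phi0 : (0 <= mean w (fun j => (h ^+ j)%:E))%E.
  by apply: mean_ge0 => // j; rewrite lee_fin.
have phi_fin : mean w (fun j => (h ^+ j)%:E) \is a fin_num.
  rewrite ge0_fin_numE//; apply: le_lt_trans (ltry 1).
  by apply: mean_le1 => // j; rewrite lee_fin.
have E1 : mean (geom h) v = ((1 - h)%:E * v 0%N + h%:E * m)%E.
  by rewrite mean_geomS.
have E2 : mean (geom h) v = (s%:E * mean w (fun j =>
    (1 - h ^+ j)%:E + (h ^+ j)%:E * m))%E.
  rewrite -(meanZ s)//; last first.
    move=> j; rewrite adde_ge0// ?mule_ge0// ?lee_fin// subr_ge0//.
  transitivity (mean (geom h) (fun y => mean w (fun j =>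
      s%:E * (if (y < j)%N then 1 else v (y - j).+1)))%E).
    apply: eq_mean => y; rewrite meanZ//; last by move=> j; case: ifP.
    rewrite /v record_gfS//; congr *%E; apply: eq_mean => j.
    rewrite /left_step; case: ltnP => // jy; last by rewrite subSn.
    by rewrite record_gf0.
  rewrite mean_swap//; last first.
    by move=> i j; rewrite mule_ge0 ?lee_fin ?(ltW s0)//; case: ifP.
  apply: eq_mean => j; rewrite meanZ//; last by move=> i; case: ifP.
  by rewrite (mean_geom_shift (F := fun n => v n.+1)).
have E3 : (mean w (fun j => (1 - h ^+ j)%:E) + mean w (fun j => (h ^+ j)%:E)
    = 1)%E.
  rewrite -meanD//; last by move=> j; rewrite lee_fin subr_ge0.
  rewrite -(mean_cst hw ler01); apply: eq_mean => j /=.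
  by rewrite -EFinD subrK.
have one_fin : mean w (fun j => (1 - h ^+ j)%:E) \is a fin_num.
  rewrite ge0_fin_numE; last first.
    by apply: mean_ge0 => // j; rewrite lee_fin subr_ge0.
  apply: le_lt_trans (ltry 1); apply: mean_le1 => // j; rewrite lee_fin.
    by rewrite subr_ge0.
  by rewrite gerBl.
rewrite -/(v 0%N) -(fineK (vfin 0%N)).
move: E1; rewrite E2 meanD//; last first.
- by move=> j; rewrite mule_ge0// lee_fin.
- by move=> j; rewrite lee_fin subr_ge0.
under [X in (_ * (_ + X))%E]eq_mean do rewrite muleC.
rewrite -(fineK mfin) (meanZ (fine m))//.
move: E3 (hE); rewrite -(fineK one_fin) -(fineK phi_fin) -(fineK (vfin 0%N)).
rewrite -?(EFinM, EFinD) => -[E3] [hE'] [E4].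
congr EFin; apply: (@mulIf _ (1 - h)); first by rewrite subr_eq0 gt_eqF.
rewrite divfK ?subr_eq0 ?gt_eqF//.
by move: E4; rewrite (_ : fine (mean w _) = 1 - fine (mean w (fun j => (h ^+ j)%:E)));
  nra.
Qed.

End first_record.

(** * Records of a deterministic path *)

Section record_times.
Context (R : realType).
Implicit Types (xi s : nat -> int).

Definition partial_sum xi n : int := \sum_(i < n) xi i.

(** The height of the running maximum above the current position,
    computed from the increments. *)
Fixpoint depth xi n : int :=
  if n is m.+1 then
    if depth xi m <= xi m then 0 else depth xi m - xi m
  else 0.

Fixpoint record_count xi n : nat :=
  if n is m.+1 then (record_count xi m + (depth xi m <= xi m)%R)%N else 0%N.

Lemma partial_sumS xi n : partial_sum xi n.+1 = partial_sum xi n + xi n.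
Proof. by rewrite /partial_sum big_ord_recr. Qed.

Lemma running_max_leP s n (x : int) :
  reflect (forall m, (m <= n)%N -> s m <= x) (running_max s n <= x).
Proof.
apply: (iffP idP) => [h m mn|h].
  apply: le_trans h; rewrite /running_max.
  by have := @le_bigmax _ _ _ (s 0%N) (fun i : 'I_n.+1 => s i)
    (Ordinal (mn : (m < n.+1)%N)).
by apply/bigmax_leP; split => [|i _]; [exact: h|apply: h; rewrite -ltnS].
Qed.

Lemma running_maxS s n :
  running_max s n.+1 = Num.max (running_max s n) (s n.+1).
Proof.
apply/eqP; rewrite eq_le; apply/andP; split.
  apply/running_max_leP => m; rewrite leq_eqVlt => /predU1P[->|mn].
    by rewrite le_max lexx orbT.
  rewrite le_max; apply/orP; left.
  exact: (running_max_leP _ _ _ (lexx _)).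
rewrite ge_max; apply/andP; split.
  apply/running_max_leP => m mn.
  by apply: (running_max_leP _ _ _ (lexx _)); exact: leqW.
exact: (running_max_leP _ _ _ (lexx _)).
Qed.

Lemma running_max_depth xi n :
  running_max (partial_sum xi) n = partial_sum xi n + depth xi n.
Proof.
elim: n => [|n IH].
  rewrite addr0 /partial_sum big_ord0; apply/eqP; rewrite eq_le.
  apply/andP; split.
    by apply/running_max_leP => m; rewrite leqn0 => /eqP ->; rewrite big_ord0.
  have := running_max_leP (partial_sum xi) 0 _ (lexx _) 0%N (leqnn _).
  by rewrite {1}/partial_sum big_ord0.
rewrite running_maxS IH partial_sumS /=.
by rewrite maxEle lerD2l; case: ifP => _; ring.
Qed.

Lemma is_recordE xi m :
  (running_max (partial_sum xi) m <= partial_sum xi m.+1) = (depth xi m <= xi m).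
Proof. by rewrite running_max_depth partial_sumS lerD2l. Qed.

Lemma record_count_nd xi : {homo record_count xi : m n / (m <= n)%N}.
Proof. by apply: homo_leq => //= [? ? ?|n]; [exact: leq_trans|exact: leq_addr]. Qed.

Lemma record_count_last xi n k : (k < record_count xi n)%N ->
  exists m, [/\ (m < n)%N, depth xi m <= xi m & (k <= record_count xi m)%N].
Proof.
elim: n => //= n IH; case: (boolP (depth xi n <= xi n)) => [h|_].
  by rewrite addn1 ltnS => kn; exists n.
rewrite addn0 => /IH[m [mn h km]]; exists m; split => //.
exact: ltnW.
Qed.

Lemma nat_inf_le (A : set nat) n :
  (ereal_inf [set (m%:R : R)%:E | m in A] <= (n%:R)%:E)%E <->
  exists2 m, A m & (m <= n)%N.
Proof.
split=> [h|[m Am mn]]; last first.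
  apply: ge_ereal_inf; exists (m%:R%:E); first by exists m.
  by rewrite lee_fin ler_nat.
apply: contrapT => noA.
suff : ((n.+1%:R : R)%:E <= ereal_inf [set (m%:R : R)%:E | m in A])%E.
  by move=> /le_trans/(_ h); rewrite lee_fin ler_nat ltnn.
apply: le_ereal_inf_tmp => _ [m Am <-]; rewrite lee_fin ler_nat.
by rewrite ltnNge; apply/negP => mn; apply: noA; exists m.
Qed.

Lemma nat_inf_lt (A : set nat) n :
  (ereal_inf [set (m%:R : R)%:E | m in A] < (n.+1%:R)%:E)%E <->
  exists2 m, A m & (m <= n)%N.
Proof.
split=> [h|/(nat_inf_le A) h]; last first.
  by apply: le_lt_trans h _; rewrite lte_fin ltr_nat.
apply: contrapT => noA.
suff : ((n.+1%:R : R)%:E <= ereal_inf [set (m%:R : R)%:E | m in A])%E.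
  by move=> /(lt_le_trans h); rewrite ltxx.
apply: le_ereal_inf_tmp => _ [m Am <-]; rewrite lee_fin ler_nat.
by rewrite ltnNge; apply/negP => mn; apply: noA; exists m.
Qed.

Local Notation rt xi := (record_time R (partial_sum xi)).

(** The strict and the large inequality are proved together because record
    times are integers or infinite, and the definition of the next record time
    refers to the previous one by a strict inequality. *)
Lemma record_time_count xi k n :
  ((rt xi k <= (n%:R)%:E)%E <-> (k <= record_count xi n)%N) /\
  ((rt xi k < (n.+1%:R)%:E)%E <-> (k <= record_count xi n)%N).
Proof.
elim: k n => [|k IH] n.
  by split; split => // _; rewrite ?lee_fin ?lte_fin ?ler0n ?ltr0n.
suff eqv : (exists2 m, (rt xi k < (m%:R)%:E)%E /\
      running_max (partial_sum xi) m.-1 <= partial_sum xi m & (m <= n)%N) <->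
    (k < record_count xi n)%N.
  by split; apply: (iff_trans _ eqv); [exact: nat_inf_le|exact: nat_inf_lt].
split=> [[[|m] [km rec mn]]|/record_count_last[m [mn rec km]]].
- have : (0 <= rt xi k)%E.
    case: (k) => [//|k'] /=; apply: le_ereal_inf_tmp => _ [m _ <-].
    by rewrite lee_fin.
  by move=> /le_lt_trans/(_ km); rewrite ltxx.
- have {}km := (IH m).2.1 km; rewrite is_recordE in rec.
  apply: leq_trans (record_count_nd xi mn) => /=.
  by rewrite rec addn1 ltnS.
- exists m.+1 => //; split; first exact/(IH m).2.
  by rewrite is_recordE.
Qed.

Lemma weak_record_numberE xi n :
  weak_record_number R (partial_sum xi) n = (record_count xi n)%:R.
Proof.
rewrite /weak_record_number.
rewrite (_ : [set _ | _ in _] =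
    [set (k%:R : R) | k in [set k | (1 <= k <= record_count xi n)%N]]); last first.
  congr image; apply/funext => k; apply/propext => /=.
  by rewrite (record_time_count xi k n).1; split => [[-> ->]|/andP[]].
have [->|c0] := posnP (record_count xi n).
  rewrite (_ : [set _ | _ in _] = set0) ?sup0//.
  apply/seteqP; split => // _ [k /= /andP[k1 k0] _].
  by move: (leq_trans k1 k0).
apply/eqP; rewrite eq_le; apply/andP; split.
  apply: ge_sup.
    by exists (record_count xi n)%:R, (record_count xi n) => //=; rewrite c0 leqnn.
  by move=> _ [k /= /andP[_ kc] <-]; rewrite ler_nat.
apply: ub_le_sup.
  by exists (record_count xi n)%:R => _ [k /= /andP[_ kc] <-]; rewrite ler_nat.
by exists (record_count xi n) => //=; rewrite c0 leqnn.
Qed.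

Lemma weak_record_number_ge xi n (r : R) : 0 <= r ->
  (r <= weak_record_number R (partial_sum xi) n) =
  (`|Num.ceil r| <= record_count xi n)%N.
Proof.
move=> r0; rewrite weak_record_numberE.
have c0 : 0 <= Num.ceil r by rewrite ceil_ge0 (lt_le_trans _ r0)// ltrN10.
by rewrite -lez_nat gez0_abs// ceil_le_int.
Qed.

End record_times.

(** * The law of the number of records *)

Section record_law.
Context d (T : measurableType d) (R : realType) (P : probability T R).
Context (X : nat -> {RV P >-> int}).
Implicit Types (a f : nat -> int).
Local Open Scope ereal_scope.

Definition prefix_event a i : set T :=
  [set t | forall j, (j < i)%N -> X j t = a j].

Lemma measurable_step i (B : set int) : measurable (X i @^-1` B).
Proof. by rewrite -[X in measurable X]setTI; exact: measurable_funP. Qed.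

(** The increments are integers, so such an event is a countable union of
    events fixing the last of the n increments. *)
Lemma measurable_finite_horizon n (F : (nat -> int) -> Prop) :
  (forall f g, (forall i, (i < n)%N -> f i = g i) -> F f -> F g) ->
  measurable [set t | F (X ^~ t)].
Proof.
elim: n F => [|n IH] F Fn.
  have [F0|F0] := pselect (F (fun=> 0%R)).
    rewrite (_ : [set _ | _] = setT)//; apply/seteqP; split => // t _.
    by apply: Fn F0.
  rewrite (_ : [set _ | _] = set0)//; apply/seteqP; split => // t Ft.
  by apply: F0; apply: Fn Ft.
rewrite (_ : [set _ | _] = \bigcup_(k : int) (X n @^-1` [set k] `&`
    [set t | F (fun i => if (i < n)%N then X i t else k)])).
  apply: countable_bigcupT_measurable => // k.
  apply: measurableI; first exact: measurable_step.
  apply: (IH (fun f => F (fun i => if (i < n)%N then f i else k))) => f g fg.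
  by apply: Fn => i _; case: ifP => // h; exact: fg.
apply/seteqP; split => [t Ft|t [k _ [/= <-]]].
  exists (X n t) => //; split => //.
  apply: Fn Ft => i; rewrite ltnS leq_eqVlt => /predU1P[->|->//].
  by rewrite ltnn.
apply: Fn => i; rewrite ltnS leq_eqVlt => /predU1P[->|->//].
by rewrite ltnn.
Qed.

Lemma depth_count_agree f g n : (forall i, (i < n)%N -> f i = g i) ->
  depth f n = depth g n /\ record_count f n = record_count g n.
Proof.
elim: n => [//|n IH] fg /=.
have [-> ->] := IH (fun i (h : (i < n)%N) => fg i (ltnW h)).
by rewrite fg.
Qed.

Lemma prefix_event_count a i t : prefix_event a i t ->
  record_count (X ^~ t) i = record_count a i.
Proof. by move=> h; have [] := depth_count_agree h. Qed.

Lemma measurable_prefix a i : measurable (prefix_event a i).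
Proof.
apply: (@measurable_finite_horizon i (fun f => forall j, (j < i)%N -> f j = a j)).
by move=> f g fg h j ji; rewrite -fg// h.
Qed.

Lemma measurable_prefix_count a i m n :
  measurable (prefix_event a i `&` [set t | (m <= record_count (X ^~ t) n)%N]).
Proof.
apply: measurableI; first exact: measurable_prefix.
apply: (@measurable_finite_horizon n (fun f => (m <= record_count f n)%N : Prop)).
by move=> f g /depth_count_agree[_ ->].
Qed.

Hypothesis indep : mutually_independent X.

Lemma prefix_eventE a i : prefix_event a i =
  \bigcap_(j in [set` [fset k in iota 0 i]%fset]) (X j @^-1` [set a j]).
Proof.
apply/seteqP; split => [t h j /=|t h j ji].
  by rewrite !inE mem_iota add0n => /h.
by apply: (h j); rewrite /= !inE mem_iota.
Qed.

Lemma prefix_event_prob a i :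
  P (prefix_event a i.+1) = P (prefix_event a i) * P (X i @^-1` [set a i]).
Proof.
rewrite !prefix_eventE !indep//.
have -> : [fset k in iota 0 i.+1]%fset = (i |` [fset k in iota 0 i])%fset.
  by apply/fsetP => j; rewrite !inE !mem_iota; lia.
by rewrite big_fsetU1 ?inE ?mem_iota ?add0n ?ltnn// muleC.
Qed.

Context (w : nat -> R) (hw : is_weight w).
Context (z : nat -> int) (z_inj : injective z).
Hypothesis law : forall i j, P (X i @^-1` [set z j]) = (w j)%:E.

(** The events that the i-th step equals z j have total mass 1, so their
    union misses a null set only. *)
Lemma total_probability i (A : set T) : measurable A ->
  P A = \sum_(0 <= j <oo) P (A `&` X i @^-1` [set z j]).
Proof.
move=> mA; pose B j := X i @^-1` [set z j].
have mB j : measurable (B j) by exact: measurable_step.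
have tB (C : set T) : trivIset setT (fun j => C `&` B j).
  apply/trivIsetP => j k _ _ jk; apply/seteqP; split => // t -[[_ tj] [_ tk]].
  by move: jk; rewrite (z_inj (etrans (esym tj) tk)) eqxx.
have sumB (C : set T) : measurable C ->
    P (C `&` \bigcup_j B j) = \sum_(0 <= j <oo) P (C `&` B j).
  move=> mC; rewrite setI_bigcupr measure_bigcup//.
    by apply: eq_eseriesl => j; rewrite in_setT.
  by move=> j _; exact: measurableI.
have mU : measurable (\bigcup_j B j) by exact: bigcupT_measurable.
have PU : P (\bigcup_j B j) = 1.
  rewrite -[X in P X]setTI sumB//; have [_ <-] := hw.
  by apply: eq_eseriesr => j _; rewrite setTI law.
rewrite -sumB// (measureDI P mA mU).
rewrite [X in X + _ = _](_ : _ = 0) ?add0e//.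
apply: (@subset_measure0 _ _ _ _ _ (~` \bigcup_j B j)).
- exact: measurableD.
- exact: measurableC.
- exact: subDsetr.
- by have := probability_setC P mU; rewrite PU subee.
Qed.

Context (step : nat -> nat -> option nat).
Hypothesis stepP : forall y j,
  if step y j is Some y' then (z j < y%:Z)%R /\ (y'%:Z = y%:Z - z j)%R
  else (y%:Z <= z j)%R.

(** Independence is assumed for rectangles, and a prefix of increments is
    one. The induction on n splits the event according to the next step and
    moves this step into the prefix. *)
Lemma prefix_record_law n k a i (y : nat) : depth a i = y%:Z ->
  P (prefix_event a i `&`
      [set t | (record_count a i + k <= record_count (X ^~ t) (i + n))%N]) =
  P (prefix_event a i) * record_prob w step n k y.
Proof.
elim: n k a i y => [|n IH] [|k] a i y ay.
- rewrite mule1; congr (P _); apply/seteqP; split => t; first by case.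
  by move=> ht; split => //=; rewrite !addn0 (prefix_event_count ht).
- rewrite mule0 (_ : _ `&` _ = set0) ?measure0//.
  apply/seteqP; split => // t [/prefix_event_count ht] /=.
  by rewrite addn0 ht addnS ltnNge leq_addr.
- rewrite mule1; congr (P _); apply/seteqP; split => t; first by case.
  move=> ht; split => //=; rewrite addn0 -(prefix_event_count ht).
  by apply: record_count_nd; rewrite leq_addr.
rewrite (total_probability i); last exact: measurable_prefix_count.
have Pfin : P (prefix_event a i) \is a fin_num by
  apply: fin_num_measure; exact: measurable_prefix.
rewrite -(fineK Pfin) [X in _ * X]/mean /= -nneseriesZl; last first.
  move=> j _; rewrite mule_ge0 ?lee_fin//; first by case: hw.
  by case: (step y j) => [y'|]; exact: record_prob_ge0.
apply: eq_eseriesr => j _.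
pose aj m := if m == i then z j else a m.
have aj_lt m : (m < i)%N -> aj m = a m by move=> mi; rewrite /aj ltn_eqF.
have [dj cj] := depth_count_agree aj_lt.
have aji : aj i = z j by rewrite /aj eqxx.
have prefE : prefix_event aj i.+1 = prefix_event a i `&` (X i @^-1` [set z j]).
  apply/seteqP; split => [t h|t [h /= hi] m].
    split; last by rewrite -aji; exact: h.
    by move=> m mi; rewrite h ?aj_lt// ltnW.
  rewrite ltnS leq_eqVlt => /predU1P[->|mi]; first by rewrite aji.
  by rewrite aj_lt// h.
have Pprod : P (prefix_event aj i.+1) = P (prefix_event a i) * (w j)%:E.
  rewrite prefix_event_prob aji law; congr (P _ * _).
  by apply/seteqP; split => t h m mi; rewrite h// aj_lt.
have -> : (prefix_event a i `&`
    [set t | (record_count a i + k.+1 <= record_count (X ^~ t) (i + n.+1))%N])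
    `&` X i @^-1` [set z j] =
    prefix_event aj i.+1 `&`
    [set t | (record_count a i + k.+1 <= record_count (X ^~ t) (i.+1 + n))%N].
  by rewrite prefE addSnnS setIAC.
rewrite (fineK Pfin) muleA -Pprod.
have depS : depth aj i.+1 = if (y%:Z <= z j)%R then 0%R else (y%:Z - z j)%R.
  by rewrite /= dj ay aji.
have cntS : record_count aj i.+1 = (record_count a i + (y%:Z <= z j)%R)%N.
  by rewrite /= cj dj ay aji.
have := stepP y j; case: (step y j) => [y' [zy y'E]|yz].
  have {}depS : depth aj i.+1 = y' by rewrite depS leNgt zy.
  have {}cntS : record_count aj i.+1 = record_count a i.
    by rewrite cntS leNgt zy addn0.
  by rewrite -(IH _ _ _ _ depS) cntS.
have {}depS : depth aj i.+1 = 0%N by rewrite depS yz.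
have {}cntS : record_count aj i.+1 = (record_count a i).+1.
  by rewrite cntS yz addn1.
by rewrite -(IH _ _ _ _ depS) cntS (addSn (record_count a i)) addnS.
Qed.

Lemma record_count_law n k :
  P [set t | (k <= record_count (X ^~ t) n)%N] = record_prob w step n k 0.
Proof.
have := @prefix_record_law n k (fun=> 0%R) 0 0 erefl.
have -> : prefix_event (fun=> 0%R) 0 = setT.
  by apply/seteqP; split => // t _ j.
by rewrite probability_setT mul1e setTI.
Qed.

End record_law.

(** * The step generating function and its fixed points *)

Section offspring_series.
Context (R : realType) (q : R) (p : nat -> R).
Hypotheses (hq : 0 < q) (hp : forall n, 0 <= p n).
Hypothesis hqp : (q%:E + \sum_(0 <= n <oo) (p n)%:E = 1)%E.

(** The law of one minus the step (resp. one plus the step), whose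
    generating function is phi; it would be the offspring law of the branching
    process coded by the walk. *)
Definition offspring (j : nat) : R := if j is n.+1 then p n else q.

Local Notation w := offspring.
Local Notation partial := (fun x : R => series (fun n => p n * x ^+ n.+1)).

Lemma offspring_ge0 j : 0 <= w j. 
Proof. by case: j => [|n]; [exact: ltW|exact: hp]. Qed.

Lemma offspring_weight : is_weight w.
Proof.
split; first exact: offspring_ge0.
rewrite nneseries_recl//; last by move=> j _; rewrite lee_fin offspring_ge0.
rewrite -(@nneseries_addn _ (fun j => (w j)%:E) 1); last first.
  by move=> j; rewrite lee_fin offspring_ge0.
by rewrite -[RHS]hqp; congr +%E; apply: eq_eseriesr => j _; rewrite addn1.
Qed.

Let term_ge0 (x : R) n : 0 <= x -> 0 <= p n * x ^+ n.+1.
Proof. by move=> x0; rewrite mulr_ge0// exprn_ge0. Qed.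

Let partial_nd (x : R) : 0 <= x -> nondecreasing_seq (partial x).
Proof.
move=> x0; apply/nondecreasing_seqP => n.
by rewrite /series/= big_nat_recr//= lerDl term_ge0.
Qed.

Lemma offspring_sum_fin : (\sum_(0 <= n <oo) (p n)%:E = (1 - q)%:E)%E.
Proof.
have s0 : (0 <= \sum_(0 <= n <oo) (p n)%:E)%E.
  by apply: nneseries_ge0 => n _ _; rewrite lee_fin.
move: hqp s0; case: (\sum_(0 <= n <oo) (p n)%:E)%E => [r| |] //.
by rewrite -EFinD => -[] <- _; rewrite addrC addKr.
Qed.

Lemma offspring_le1 : q <= 1.
Proof.
rewrite -subr_ge0 -lee_fin -offspring_sum_fin.
by apply: nneseries_ge0 => n _ _; rewrite lee_fin.
Qed.

Lemma partial_mass n : \sum_(0 <= i < n) p i <= 1 - q.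
Proof.
rewrite -lee_fin -offspring_sum_fin -sumEFin.
by apply: nneseries_lim_ge => i _ _; rewrite lee_fin.
Qed.

Lemma is_cvg_partial (x : R) : 0 <= x <= 1 -> cvgn (partial x).
Proof.
move=> /andP[x0 x1]; apply: nondecreasing_is_cvgn; first exact: partial_nd.
exists (1 - q) => _ [n _ <-]; apply: le_trans (partial_mass n).
rewrite /series/=; apply: ler_sum => i _.
by rewrite -[leRHS]mulr1 ler_wpM2l// exprn_ile1.
Qed.

Lemma phi_mean (x : R) : 0 <= x <= 1 ->
  mean w (fun j => (x ^+ j)%:E) = (phi q p x)%:E.
Proof.
move=> x01; have /andP[x0 x1] := x01.
rewrite mean_recl; [|exact: offspring_weight|]; last first.
  by move=> j; rewrite lee_fin exprn_ge0.
rewrite expr0 mule1 /phi EFinD; congr +%E.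
rewrite -EFin_lim; last exact: is_cvg_partial.
by apply: congr_lim; apply/funext => n /=; rewrite /series /= sumEFin.
Qed.

Lemma phi_pseries (x : R) : 0 <= x <= 1 -> pseries w x @ \oo --> phi q p x.
Proof.
move=> x01; rewrite -cvg_shiftS /phi.
rewrite (_ : [sequence _]_n = (fun n => q + partial x n)); last first.
  apply/funext => n /=; rewrite /pseries /series /= big_nat_recl//=.
  by rewrite expr0 mulr1.
by apply: cvgD; [exact: cvg_cst|exact: is_cvg_partial].
Qed.

Lemma phi_ge (x : R) : 0 <= x <= 1 -> q <= phi q p x.
Proof.
move=> x01; rewrite lerDl; apply: limr_ge; first exact: is_cvg_partial.
apply: nearW => n; apply: sumr_ge0 => i _; apply: term_ge0.
by case/andP: x01.
Qed.

Lemma expr_secant_le (x y : R) n : 0 <= x -> x <= y -> y <= 1 ->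
  y ^+ n - x ^+ n <= n%:R * (y - x).
Proof.
move=> x0 xy y1; elim: n => [|n IH]; first by rewrite !expr0 subrr mul0r.
rewrite !exprS -natr1.
have xn1 : x ^+ n <= 1 by rewrite exprn_ile1// (le_trans xy).
have xn0 : 0 <= x ^+ n by rewrite exprn_ge0.
have : y * (y ^+ n - x ^+ n) <= n%:R * (y - x).
  apply: le_trans IH; rewrite -[leRHS]mul1r ler_wpM2r// subr_ge0.
  by rewrite lerXn2r ?nnegrE// (le_trans x0).
have : (y - x) * x ^+ n <= y - x by rewrite -[leRHS]mulr1 ler_wpM2l ?subr_ge0.
lra.
Qed.

Lemma expr_secant_ge (y : R) n : 0 <= y -> y <= 1 ->
  n%:R * (1 - y) * y ^+ n <= 1 - y ^+ n.
Proof.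
move=> y0 y1; elim: n => [|n IH]; first by rewrite !mul0r expr0 subrr.
rewrite exprS -natr1.
have yn1 : y ^+ n <= 1 by rewrite exprn_ile1.
have yn0 : 0 <= y ^+ n by rewrite exprn_ge0.
have h1 : y * (n%:R * (1 - y) * y ^+ n) <= y * (1 - y ^+ n) by rewrite ler_wpM2l.
have h2 : y * ((1 - y) * y ^+ n) <= 1 - y.
  have -> : y * ((1 - y) * y ^+ n) = (1 - y) * (y * y ^+ n) by ring.
  rewrite -[leRHS]mulr1 ler_wpM2l ?subr_ge0//.
  by rewrite mulr_ile1.
lra.
Qed.

(** This bound comes from writing y^{n+1} = y - y (1 - y^n) and keeping only
    the first M terms of the sum of the p n (1 - y^n). *)
Lemma phi_le (y : R) M : 0 <= y <= 1 ->
  phi q p y <= 1 - (1 - q) * (1 - y)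
               - y * ((1 - y) * (y ^+ M * \sum_(0 <= n < M) n%:R * p n)).
Proof.
move=> y01; have /andP[y0 y1] := y01.
rewrite /phi -lerBrDl; apply: limr_le; first exact: is_cvg_partial.
near=> n.
have Mn : (M <= n)%N by near: n; exact: nbhs_infty_ge.
have -> : partial y n = y * \sum_(0 <= i < n) p i
    - y * \sum_(0 <= i < n) p i * (1 - y ^+ i).
  rewrite /series/= -mulrBr -sumrB mulr_sumr; apply: eq_bigr => i _.
  by rewrite exprS; ring.
have h1 : y * \sum_(0 <= i < n) p i <= y * (1 - q).
  by rewrite ler_wpM2l// partial_mass.
have h2 : (1 - y) * (y ^+ M * \sum_(0 <= n < M) n%:R * p n) <=
    \sum_(0 <= i < n) p i * (1 - y ^+ i).
  apply: (@le_trans _ _ (\sum_(0 <= i < M) p i * (1 - y ^+ i))).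
    rewrite mulrA mulr_sumr !big_nat; apply: ler_sum => i /andP[_ iM].
    apply: (@le_trans _ _ (p i * (i%:R * (1 - y) * y ^+ i))).
      have -> : (1 - y) * y ^+ M * (i%:R * p i) =
        (p i * (i%:R * (1 - y))) * y ^+ M by ring.
      rewrite [leRHS]mulrA ler_wpM2l ?mulr_ge0 ?subr_ge0//.
      by rewrite ler_wiXn2l// ltnW.
    by rewrite ler_wpM2l// expr_secant_ge.
  rewrite (big_cat_nat (leq0n M) Mn)/=.
  rewrite lerDl big_nat sumr_ge0// => i _.
  by rewrite mulr_ge0// subr_ge0 exprn_ile1.
have := ler_wpM2l y0 h2; lra.
Unshelve. all: end_near. Qed.

Lemma phi_le1 (y : R) : 0 <= y <= 1 -> phi q p y <= 1.
Proof.
move=> y01; have /andP[y0 y1] := y01.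
have := phi_le 0 y01; rewrite big_geq// !mulr0 subr0 => /le_trans; apply.
by rewrite gerBl mulr_ge0 ?subr_ge0// offspring_le1.
Qed.

Lemma phi1 : phi q p 1 = 1.
Proof.
have h01 : 0 <= (1 : R) <= 1 by rewrite ler01 lexx.
have [w0 w1] := offspring_weight.
apply/EFin_inj; rewrite -phi_mean// -[RHS]w1 /mean.
by apply: eq_eseriesr => j _; rewrite expr1n mule1.
Qed.

Hypothesis phi'1 : is_left_derivative (phi q p) 1 1.

(** Half of the statement that the walk is centred: divide the bound phi_le
    by 1 - y and let y tend to 1. *)
Lemma drift_le M : \sum_(0 <= n < M) n%:R * p n <= q.
Proof.
set S := \sum_(0 <= n < M) _.
have lim : 1 - q + y * (y ^+ M * S) @[y --> 1^'-] --> 1 - q + 1 * (1 ^+ M * S).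
  have y1 : (fun y : R => y) y @[y --> 1^'-] --> (1 : R) by exact: cvg_within.
  apply: cvgD; first exact: cvg_cst.
  apply: cvgM => //; apply: cvgMl; apply: cvg_at_left_filter.
  exact: exprn_continuous.
rewrite expr1n !mul1r in lim.
suff : 1 - q + S <= 1 by lra.
apply: (ler_cvg_to lim phi'1).
near=> y.
have y1 : y < 1 by near: y; exact: nbhs_left_lt.
have y0 : 0 < y by near: y; exact: nbhs_left_gt.
have y01 : 0 <= y <= 1 by rewrite !ltW.
rewrite phi1 -[phi q p y - 1]opprB -[y - 1]opprB invrN mulrNN.
rewrite ler_pdivlMr ?subr_gt0//.
have := phi_le M y01; rewrite -/S; lra.
Unshelve. all: end_near. Qed.

(** For q = 1 the function phi would be constant, with derivative 0 at 1. *)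
Lemma offspring_lt1 : q < 1.
Proof.
rewrite lt_neqAle offspring_le1 andbT; apply/eqP => q1.
have : (phi q p y - phi q p 1) / (y - 1) @[y --> 1^'-] --> (0 : R).
  apply: (@cvg_near_eq _ _ _ _ (cst 0)); last exact: cvg_cst.
  near=> y.
  have y1 : y < 1 by near: y; exact: nbhs_left_lt.
  have y0 : 0 < y by near: y; exact: nbhs_left_gt.
  have y01 : 0 <= y <= 1 by rewrite !ltW.
  have -> : phi q p y = 1.
    by apply/eqP; rewrite eq_le phi_le1//= -{1}q1 phi_ge.
  by rewrite phi1 subrr mul0r.
move=> /(cvg_unique (@Rhausdorff R) phi'1)/eqP.
by rewrite oner_eq0.
Unshelve. all: end_near. Qed.

Lemma phi_lt1 (y : R) : 0 <= y < 1 -> phi q p y < 1.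
Proof.
move=> /andP[y0 y1]; have y01 : 0 <= y <= 1 by rewrite y0 ltW.
have := phi_le 0 y01; rewrite big_geq// !mulr0 subr0 => /le_lt_trans; apply.
by rewrite gtrBl mulr_gt0 ?subr_gt0// offspring_lt1.
Qed.

(** The map x / phi(x) increases: the difference of the two sides is
    q (y - x) - x y (sum of the p n (y^n - x^n)), each y^n - x^n is at most
    n (y - x), and the drift bound leaves at least q (y - x) (1 - x y). *)
Lemma phi_ratio_decr (x y : R) : 0 < x -> x < y -> y <= 1 ->
  phi q p y * x < phi q p x * y.
Proof.
move=> x0 xy y1; have y0 := lt_trans x0 xy; have x1 := lt_le_trans xy y1.
have x01 : 0 <= x <= 1 by rewrite !ltW.
have y01 : 0 <= y <= 1 by rewrite y1 ltW.
have lim : partial y n * x - partial x n * y @[n --> \oo] -->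
    limn (partial y) * x - limn (partial x) * y.
  by apply: cvgB; apply: cvgMl; exact: is_cvg_partial.
have le : limn (partial y) * x - limn (partial x) * y <= x * y * (y - x) * q.
  rewrite -(cvg_lim _ lim)//; apply: limr_le; first exact: cvgP lim.
  apply: nearW => n.
  apply: (@le_trans _ _ (x * y * (y - x) * \sum_(0 <= i < n) i%:R * p i)).
    rewrite /series /= !mulr_suml -sumrB mulr_sumr; apply: ler_sum => i _.
    have -> : p i * y ^+ i.+1 * x - p i * x ^+ i.+1 * y =
      (x * y * p i) * (y ^+ i - x ^+ i) by rewrite !exprS; ring.
    have -> : x * y * (y - x) * (i%:R * p i) =
      (x * y * p i) * (i%:R * (y - x)) by ring.
    rewrite ler_wpM2l ?expr_secant_le ?(ltW xy) ?(ltW x0)//.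
    by rewrite !mulr_ge0// ltW.
  by rewrite ler_wpM2l ?drift_le// !mulr_ge0 ?subr_ge0// ltW.
rewrite /phi !mulrDl.
have : 0 < q * (y - x) * (1 - x * y).
  rewrite !mulr_gt0 ?subr_gt0//.
  by apply: lt_le_trans y1; rewrite -[X in _ < X]mul1r ltr_pM2r.
lra.
Qed.

End offspring_series.

Section power_series_derivative.
Context (R : realType).

(** Bound n.+1 k^n by (k'^{n+1} - k^{n+1}) / (k' - k), so that the
    derived series is dominated by the original one at a larger argument. *)
Lemma is_cvg_pseries_diffs (c : nat -> R) (k k' : R) :
  (forall j, 0 <= c j) -> 0 <= k -> k < k' ->
  cvgn (pseries c k') -> cvgn (pseries (pseries_diffs c) k).
Proof.
move=> c0 k0 kk' ck'; have k'0 : 0 < k' by exact: le_lt_trans kk'.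
have pow n : n.+1%:R * k ^+ n * (k' - k) <= k' ^+ n.+1 - k ^+ n.+1.
  elim: n => [|n IH]; first by rewrite !expr1 expr0; lra.
  have h1 := ler_wpM2l k0 IH.
  have h2 : k ^+ n.+1 <= k' ^+ n.+1 by rewrite lerXn2r ?nnegrE// ltW.
  have h3 : k * k ^+ n * (k' - k) <= k' ^+ n.+1 * (k' - k).
    by rewrite -exprS ler_wpM2r// subr_ge0 ltW.
  by move: h1 h3; rewrite -(natr1 n.+1) !exprS; lra.
apply: (@series_le_cvg _ _ (fun i => (k' - k)^-1 * (c i.+1 * k' ^+ i.+1))).
- by move=> n; rewrite /pseries_diffs !mulr_ge0// exprn_ge0.
- by move=> n; rewrite !mulr_ge0 ?invr_ge0 ?subr_ge0 ?exprn_ge0// ltW.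
- move=> n; rewrite ler_pdivlMl ?subr_gt0// /pseries_diffs.
  have -> : (k' - k) * (n.+1%:R * c n.+1 * k ^+ n) =
    c n.+1 * (n.+1%:R * k ^+ n * (k' - k)) by ring.
  rewrite ler_wpM2l//; apply: le_trans (pow n) _.
  by rewrite gerBl exprn_ge0.
- apply: is_cvg_seriesZ; apply/cvg_ex; exists (limn (pseries c k') - c 0%N).
  rewrite (_ : series _ = (fun n => pseries c k' n.+1 - c 0%N)); last first.
    apply/funext => n; rewrite /pseries /series /= big_nat_recl//=.
    by rewrite expr0 mulr1 addrAC subrr add0r.
  apply: cvgB; last exact: cvg_cst.
  have : pseries c k' @ \oo --> limn (pseries c k') by [].
  by rewrite -cvg_shiftS.
Qed.

End power_series_derivative.

Section fixed_point.
Context (R : realType) (q : R) (p : nat -> R).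
Hypotheses (hq : 0 < q) (hp : forall n, 0 <= p n).
Hypothesis hqp : (q%:E + \sum_(0 <= n <oo) (p n)%:E = 1)%E.

Lemma phi_derivable (x : R) : 0 < x < 1 -> derivable (phi q p) x 1.
Proof.
move=> /andP[x0 x1]; set w := offspring q p.
have w0 j : 0 <= w j by exact: offspring_ge0.
(* Each of the two derived series needs a smaller radius than the previous
   one: the radii k 3, k 2, k 1 lie between x and 1. *)
pose k i := x + (1 - x) * i%:R / 4.
have cw y : 0 <= y <= 1 -> cvgn (pseries w y).
  by move=> y01; apply: cvgP; exact: phi_pseries.
have d0 j : 0 <= pseries_diffs w j by rewrite mulr_ge0.
have c3 : cvgn (pseries w (k 3)) by apply: cw; rewrite /k; lra.
have c1 : cvgn (pseries w (k 1)) by apply: cw; rewrite /k; lra.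
have c2 : cvgn (pseries (pseries_diffs w) (k 2)).
  by apply: (is_cvg_pseries_diffs w0 _ _ c3); rewrite /k; lra.
have c1' : cvgn (pseries (pseries_diffs w) (k 1)).
  by apply: (is_cvg_pseries_diffs w0 _ _ c3); rewrite /k; lra.
have c1'' : cvgn (pseries (pseries_diffs (pseries_diffs w)) (k 1)).
  by apply: (is_cvg_pseries_diffs d0 _ _ c2); rewrite /k; lra.
have xk : `|x| < `|k 1| by rewrite !gtr0_norm// /k; lra.
have [dx _] := pseries_snd_diffs c1 c1' c1'' xk.
apply: near_eq_derivable dx; near=> y.
have y0 : 0 < y by near: y; exact: lt_nbhsr.
have y1 : y < 1 by near: y; exact: lt_nbhsl.
by apply: cvg_lim => //; apply: phi_pseries => //; rewrite !ltW.
Unshelve. all: end_near. Qed.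

Hypothesis phi'1 : is_left_derivative (phi q p) 1 1.

(** Both fixed points have the ratio x / phi(x) = s, and this ratio is
    strictly increasing. *)
Lemma fixed_point_unique (s x y : R) : 0 < s < 1 ->
  0 < x < 1 -> x = s * phi q p x -> 0 <= y <= 1 -> y = s * phi q p y -> y = x.
Proof.
move=> /andP[s0 s1] /andP[x0 x1] xE y01 yE; have /andP[y0 y1] := y01.
have y0' : 0 < y.
  by rewrite yE mulr_gt0// (lt_le_trans hq)// phi_ge.
have y1' : y < 1.
  rewrite lt_neqAle y1 andbT; apply/eqP => yy; move: yE.
  by rewrite yy phi1// mulr1 => ss; rewrite -ss ltxx in s1.
have cross (u v : R) : u = s * phi q p u -> v = s * phi q p v ->
    0 < u -> u < v -> v < 1 -> False.
  move=> uE vE u0 uv v1.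
  have := phi_ratio_decr hq hp hqp phi'1 u0 uv (ltW v1).
  rewrite -(ltr_pM2l s0) !mulrA -uE -vE mulrC ltxx //.
case: (ltgtP y x) => // [yx|xy].
  by case: (cross y x).
by case: (cross x y).
Qed.

Lemma minimal_solution_eq (s x : R) : 0 < s < 1 ->
  0 < x < 1 -> x = s * phi q p x -> minimal_solution q p s = x.
Proof.
move=> s01 x01 xE; have /andP[x0 x1] := x01.
have : is_minimal_solution q p s x.
  split => //; first by rewrite !ltW.
  move=> y y01 yE; rewrite le_eqVlt; apply/orP; left; apply/eqP.
  by apply/esym; exact: (fixed_point_unique s01 x01).
move=> xP; have [m01 mE _] := xgetPex 0 (ex_intro _ x xP).
exact: (fixed_point_unique s01 x01).
Qed.

(** The function s phi(x) - x changes sign between s q / 2 and s, where phi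
    is continuous because it is a power series. *)
Lemma minimal_solutionP (s : R) : 0 < s < 1 ->
  let h := minimal_solution q p s in 0 < h < 1 /\ h = s * phi q p h.
Proof.
move=> s01; have /andP[s0 s1] := s01.
have q1 := offspring_le1 hp hqp.
pose a := s * q / 2.
have a0 : 0 < a by rewrite divr_gt0// mulr_gt0.
have as_ : a <= s.
  by rewrite /a ler_pdivrMr// ler_wpM2l ?(ltW s0)//; lra.
have [||x x_in xE] := @IVT R (fun x => s * phi q p x - x) a s 0 as_.
- apply: derivable_within_continuous => x; rewrite in_itv/= => /andP[ax xs].
  apply: derivableB => //; apply: derivableZ; apply: phi_derivable.
  by rewrite (lt_le_trans a0)//= (le_lt_trans xs).
- have A : 0 <= s * phi q p a - a.
    rewrite subr_ge0; apply: (@le_trans _ _ (s * q)); first by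
      have := mulr_gt0 s0 hq; rewrite /a; lra.
    rewrite ler_wpM2l ?(ltW s0)// phi_ge//.
    by rewrite (ltW a0) (le_trans as_)// ltW.
  have B : s * phi q p s - s <= 0.
    rewrite subr_le0 -[leRHS]mulr1 ler_wpM2l ?(ltW s0)// phi_le1//.
    by rewrite !ltW.
  by rewrite ge_min le_max A B orbT.
- have /andP[ax xs] : a <= x <= s by [].
  have x01 : 0 < x < 1 by rewrite (lt_le_trans a0)//= (le_lt_trans xs).
  have {}xE : x = s * phi q p x by move/eqP: xE; rewrite subr_eq0 => /eqP.
  by rewrite /= (minimal_solution_eq s01 x01 xE).
Qed.

End fixed_point.

(** * Behaviour of the minimal solution near one *)

Section root_asymptotics.
Context (R : realType) (q : R) (p : nat -> R).
Hypotheses (hq : 0 < q) (hp : forall n, 0 <= p n).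
Hypothesis hqp : (q%:E + \sum_(0 <= n <oo) (p n)%:E = 1)%E.
Hypothesis phi'1 : is_left_derivative (phi q p) 1 1.

Local Notation phi := (phi q p).
Local Notation g := (fun x : R => x / phi x).
Local Notation h := (minimal_solution q p).
Local Notation dg :=
  (fun x : R => (phi x - x * phi^`()%classic x) / phi x ^+ 2).

Lemma phi_gt0 (x : R) : 0 <= x <= 1 -> 0 < phi x.
Proof. by move=> x01; apply: lt_le_trans hq _; exact: phi_ge. Qed.

(** The upper bound is the strict monotonicity of x / phi(x), whose value
    at 1 is 1. *)
Lemma inverse_root_in (x : R) : 0 < x < 1 -> x <= g x < 1.
Proof.
move=> /andP[x0 x1]; have x01 : 0 <= x <= 1 by rewrite !ltW.
have f0 := phi_gt0 x01.
rewrite ler_pdivlMr// ltr_pdivrMr// mul1r; apply/andP; split.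
  by rewrite ger_pMr// phi_le1.
have := phi_ratio_decr hq hp hqp phi'1 x0 x1 (lexx 1).
by rewrite phi1// mul1r mulr1.
Qed.

Lemma minimal_solution_inverse (x : R) : 0 < x < 1 -> h (g x) = x.
Proof.
move=> x01; have /andP[xg g1] := inverse_root_in x01.
have /andP[x0 x1] := x01.
apply: minimal_solution_eq => //; first by rewrite g1 (lt_le_trans x0 xg).
by rewrite divfK// gt_eqF// phi_gt0// !ltW.
Qed.

Lemma cvg_minimal_solution : h s @[s --> 1^'-] --> 1^'-.
Proof.
apply: cvg_to_at_left; last first.
  near=> s; have s01 : 0 < s < 1.
    by apply/andP; split; near: s; [exact: nbhs_left_gt|exact: nbhs_left_lt].
  by have [/andP[]] := minimal_solutionP hq hp hqp phi'1 s01.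
apply/cvgrPdist_lt => e e0.
(* The maximum with 1/2 keeps z positive when e > 1. *)
pose z := Num.max (1 - e) (1 / 2).
have z01 : 0 < z < 1 by rewrite /z lt_max gt_max; lra.
have /andP[_ gz1] := inverse_root_in z01.
near=> s.
have s1 : s < 1 by near: s; exact: nbhs_left_lt.
have s01 : 0 < s < 1 by rewrite s1 andbT; near: s; exact: nbhs_left_gt.
have [/andP[h0 h1] hE] := minimal_solutionP hq hp hqp phi'1 s01.
rewrite gtr0_norm ?subr_gt0// ltrBlDl -ltrBlDr.
have zs : g z < s by near: s; exact: nbhs_left_gt.
suff : z < h s by apply: le_lt_trans; rewrite /z le_max lexx.
rewrite ltNge; apply/negP => hz; have /andP[z0 z1] := z01.
have fz : 0 < phi z by rewrite phi_gt0// !ltW.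
have fh : 0 < phi (h s) by rewrite phi_gt0// !ltW.
have sE : g (h s) = s by rewrite {1}hE mulfK// gt_eqF.
move: zs; rewrite -sE ltr_pdivrMr// mulrAC ltr_pdivlMr// => zs.
move: hz; rewrite le_eqVlt => /predU1P[hz|hz].
  by move: zs; rewrite hz ltxx.
have := phi_ratio_decr hq hp hqp phi'1 h0 hz (ltW z1).
by rewrite mulrC => /(lt_trans zs); rewrite mulrC ltxx.
Unshelve. all: end_near. Qed.

Context (a c : R) (a01 : 0 < a < 1).
Hypothesis hlim : (1 - s * phi^`()%classic (h s)) / (1 - s) `^ a
            @[s --> 1^'-] --> c.

Lemma cvg_inverse_root : g x @[x --> 1^'-] --> 1^'-.
Proof.
have x1 : (fun x : R => x) x @[x --> 1^'-] --> (1 : R) by exact: cvg_within.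
have near01 : \forall x \near (1 : R)^'-, 0 < x < 1.
  near=> x; apply/andP; split; near: x; [exact: nbhs_left_gt|exact: nbhs_left_lt].
apply: cvg_to_at_left.
  apply: (squeeze_cvgr _ x1 (cvg_cst (1 : R))).
  by apply: filterS near01 => x /inverse_root_in/andP[-> /ltW].
by apply: filterS near01 => x /inverse_root_in/andP[].
Unshelve. all: end_near. Qed.

Lemma is_derive_inverse_root (x : R) : 0 < x < 1 ->
  is_derive x 1 g ((phi x - x * phi^`()%classic x) / phi x ^+ 2).
Proof.
move=> x01; have f0 : phi x != 0.
  by rewrite gt_eqF// phi_gt0//; case/andP: x01 => *; rewrite !ltW.
have df : is_derive x 1 phi (phi^`()%classic x).
  by rewrite derive1E; apply: derivableP; exact: phi_derivable.
have dV := is_deriveV f0 df.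
have D := @is_deriveM _ _ (id : R -> R) (fun y : R => (phi y)^-1) x 1 _ _
  (is_derive_id x 1) dV.
apply: (@is_derive_eq _ _ _ _ _ _ _ _ D).
rewrite /GRing.scale /=; field.
by rewrite f0.
Qed.

(** Since 1 - g(x) phi'(x) = phi(x) g'(x), the hypothesis on the minimal
    solution is the limit of phi g' (1 - g)^{-a} at 1. De l'Hopital's rule turns
    it into a limit of (1 - g)^{1-a} / (1 - x), in which x = h(s) is then
    substituted. Working with g avoids differentiating h. *)
Lemma cvg_root_asymptotics :
  (1 - s) `^ (1 - a) / (1 - h s) @[s --> 1^'-] --> c * (1 - a).
Proof.
have /andP[a0 a1] := a01.
have near01 : \forall x \near (1 : R)^'-, 0 < x < 1.
  near=> x; apply/andP; split; near: x; [exact: nbhs_left_gt|exact: nbhs_left_lt].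
have x1 : (fun x : R => x) x @[x --> 1^'-] --> (1 : R) by exact: cvg_within.
have phi_to1 : phi x @[x --> 1^'-] --> (1 : R).
  apply: (squeeze_cvgr _ x1 (cvg_cst (1 : R))).
  apply: filterS near01 => x x01; have /andP[x0 xl] := x01.
  have x01' : 0 <= x <= 1 by rewrite !ltW.
  rewrite phi_le1// andbT.
  have /andP[_] := inverse_root_in x01.
  by rewrite ltr_pdivrMr ?phi_gt0// mul1r => /ltW.
have main : (1 - g x) `^ (1 - a) / (1 - x) @[x --> 1^'-] --> c * (1 - a).
  apply: (@lhopital_at_left R (fun x => (1 - g x) `^ (1 - a))
    (fun x => (1 - a) * (1 - g x) `^ (1 - a - 1) * (0 - dg x))
    (fun x => 1 - x) (fun=> -1) 0 1 _ ltr01).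
  - move=> x; rewrite in_itv/= => x01; have /andP[_ g1] := inverse_root_in x01.
    apply: (@is_derive1_comp _ (fun y => y `^ (1 - a)) (fun x => 1 - g x)).
      by apply: is_derive1_powR; rewrite subr_gt0.
    exact: (is_deriveB (is_derive_cst (1 : R) x 1) (is_derive_inverse_root x01)).
  - move=> x _; rewrite -[-1]sub0r.
    exact: (is_deriveB (is_derive_cst (1 : R) x 1) (is_derive_id x 1)).
  - apply: (@cvg_comp _ _ _ (fun x => 1 - g x) (fun t => t `^ (1 - a)) _ 0^'+).
      apply: cvg_to_at_right.
        rewrite -[X in _ --> X](subrr 1); apply: cvgB; first exact: cvg_cst.
        exact: (cvg_trans cvg_inverse_root (cvg_within _)).
      by apply: filterS near01 => x /inverse_root_in/andP[_]; rewrite subr_gt0.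
    by apply: powR_cvg0; rewrite subr_gt0.
  - by rewrite -[X in _ --> X](subrr 1); apply: cvgB => //; exact: cvg_cst.
  - by move=> x _; rewrite oppr_eq0 oner_eq0.
  have l1 := cvg_comp g _ cvg_inverse_root hlim.
  have l2 : (1 - g x * phi^`()%classic (h (g x))) / (1 - g x) `^ a
     * (1 - a) / phi x @[x --> 1^'-] --> c * (1 - a) / 1.
    apply: cvgM; last exact: cvgV.
    by apply: cvgMl.
  rewrite divr1 in l2.
  apply: (cvg_near_eq _ l2).
  apply: filterS near01 => x x01; have /andP[_ g1] := inverse_root_in x01.
  have /andP[x0 xl] := x01.
  have f0 : phi x != 0 by rewrite gt_eqF// phi_gt0// !ltW.
  rewrite minimal_solution_inverse//=.
  have -> : 1 - a - 1 = - a by ring.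
  rewrite powRN; field.
  by rewrite f0 gt_eqF// powR_gt0// subr_gt0.
have := cvg_comp h _ cvg_minimal_solution main.
apply: cvg_near_eq; near=> s.
have s01 : 0 < s < 1.
  by apply/andP; split; near: s; [exact: nbhs_left_gt|exact: nbhs_left_lt].
have [/andP[h0 h1] hE] := minimal_solutionP hq hp hqp phi'1 s01.
have fh : 0 < phi (h s) by rewrite phi_gt0// !ltW.
by rewrite /= {1}hE mulfK// gt_eqF.
Unshelve. all: end_near. Qed.

End root_asymptotics.

(** * Truncating a geometric average *)

Section geometric_tails.
Context (R : realType).
Implicit Types (u : nat -> R) (s : R).

Lemma mean_geom_tail s N : 0 <= s < 1 ->
  mean (geom s) (fun n => if (n < N)%N then 0%E else 1%E) = (s ^+ N)%:E.
Proof.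
move=> s01; elim: N => [|N IH].
  by rewrite expr0; exact: (mean_cst (geom_weight s01) ler01).
rewrite mean_geomS //; last by move=> j; case: ifP.
by rewrite /= mule0 add0e exprS EFinM -IH.
Qed.

(** Markov's inequality: the times from n on have geometric mass s^n, and
    u is at least u n there. *)
Lemma geom_mean_ge u s n (A : R) : 0 <= s < 1 -> (forall m, 0 <= u m) ->
  {homo u : m k / (m <= k)%N >-> m <= k} ->
  mean (geom s) (EFin \o u) = A%:E -> u n * s ^+ n <= A.
Proof.
move=> s01 u0 und uA; rewrite -lee_fin -uA EFinM -mean_geom_tail//.
rewrite -meanZ; [|exact: geom_weight|by move=> j; case: ifP].
apply: le_mean; first exact: geom_weight.
  by move=> j; case: ifP; rewrite ?mule0// mule1 lee_fin.
move=> j; case: ltnP => nj; rewrite ?mule0 ?mule1 lee_fin//.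
exact: und.
Qed.

(** If the average with parameter s is mostly due to times in [N, n], it
    bounds u n from below. Times before N are compared with the average of
    parameter s1 < s, times after n with the average of parameter s2 > s. *)
Lemma geom_mean_le u s s1 s2 N n (A A1 A2 : R) :
  (N <= n)%N -> 0 < s1 -> s1 < s -> s < s2 -> s2 < 1 ->
  (forall m, 0 <= u m) -> {homo u : m k / (m <= k)%N >-> m <= k} ->
  mean (geom s) (EFin \o u) = A%:E ->
  mean (geom s1) (EFin \o u) = A1%:E ->
  mean (geom s2) (EFin \o u) = A2%:E ->
  A <= u n * s ^+ N + (1 - s) / (1 - s1) * (s / s1) ^+ N * A1
       + (1 - s) / (1 - s2) * (s / s2) ^+ n * A2.
Proof.
move=> Nn s1_0 s1s ss2 s2_1 u0 und uA uA1 uA2.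
have s0 : 0 < s by exact: lt_trans s1s.
have s20 : 0 < s2 by exact: lt_trans ss2.
have s1' : s < 1 by exact: lt_trans s2_1.
have s11 : s1 < 1 by exact: lt_trans s1'.
have ws1 : is_weight (geom s1) by apply: geom_weight; rewrite ltW//=.
have ws2 : is_weight (geom s2) by apply: geom_weight; rewrite ltW//=.
have ws : is_weight (geom s) by apply: geom_weight; rewrite ltW//=.
set c1 := _ * (s / s1) ^+ N; set c2 := _ * (s / s2) ^+ n.
have c10 : 0 <= c1.
  by rewrite mulr_ge0 ?exprn_ge0 ?divr_ge0 ?subr_ge0// ltW.
have c20 : 0 <= c2.
  by rewrite mulr_ge0 ?exprn_ge0 ?divr_ge0 ?subr_ge0// ltW.
rewrite -lee_fin -uA !EFinD !EFinM -uA1 -uA2.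
rewrite -(@mean_geom_tail s N) ?(ltW s0)//= -!EFinM.
have g0 j : (0 <= (geom s j)%:E * (if (j < N)%N then 0 else 1))%E.
  by rewrite mule_ge0 ?lee_fin//; [case: ws|case: ifP].
have g1 j : (0 <= (geom s1 j)%:E * (EFin \o u) j)%E.
  by rewrite mule_ge0 ?lee_fin//; case: ws1.
have g2 j : (0 <= (geom s2 j)%:E * (EFin \o u) j)%E.
  by rewrite mule_ge0 ?lee_fin//; case: ws2.
have h0 j : (0 <= (u n)%:E * ((geom s j)%:E * (if (j < N)%N then 0 else 1)))%E.
  by rewrite mule_ge0// lee_fin.
have h1 j : (0 <= c1%:E * ((geom s1 j)%:E * (EFin \o u) j))%E.
  by rewrite mule_ge0// lee_fin.
have h2 j : (0 <= c2%:E * ((geom s2 j)%:E * (EFin \o u) j))%E.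
  by rewrite mule_ge0// lee_fin.
rewrite /mean -!nneseriesZl// -nneseriesD//.
rewrite -nneseriesD//; last by move=> j _ _; rewrite adde_ge0.
apply: lee_nneseries => [j _ _|j _].
  by rewrite mule_ge0// lee_fin; case: ws => /(_ j).
have -> : (if (j < N)%N then 0 else 1)%E = (~~ (j < N)%N)%:R%:E :> \bar R.
  by case: ifP.
rewrite -!EFinM -!EFinD lee_fin /geom.
have k0 : 0 <= u n * ((1 - s) * s ^+ j * (~~ (j < N)%N)%:R).
  by rewrite !mulr_ge0 ?exprn_ge0 ?subr_ge0 ?ler0n ?u0 // ltW.
have k1 : 0 <= c1 * ((1 - s1) * s1 ^+ j * u j).
  by apply: mulr_ge0 => //; rewrite !mulr_ge0 ?exprn_ge0 ?subr_ge0 ?u0 // ltW.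
have k2 : 0 <= c2 * ((1 - s2) * s2 ^+ j * u j).
  by apply: mulr_ge0 => //; rewrite !mulr_ge0 ?exprn_ge0 ?subr_ge0 ?u0 // ltW.
have e1 : c1 * ((1 - s1) * s1 ^+ j * u j)
    = (1 - s) * ((s / s1) ^+ N * s1 ^+ j) * u j.
  by rewrite /c1; field; rewrite subr_eq0 !gt_eqF.
have e2 : c2 * ((1 - s2) * s2 ^+ j * u j)
    = (1 - s) * ((s / s2) ^+ n * s2 ^+ j) * u j.
  by rewrite /c2; field; rewrite subr_eq0 !gt_eqF.
have e s' : s' != 0 -> s ^+ j = (s / s') ^+ j * s' ^+ j.
  by move=> s'0; rewrite -exprMn divfK.
have s1s0 : 0 <= 1 - s by rewrite subr_ge0 ltW.
have sum3 (x y z t : R) : 0 <= x -> 0 <= y -> 0 <= z ->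
    [\/ t <= x, t <= y | t <= z] -> t <= x + y + z by move=> ? ? ? []; lra.
apply: sum3 => //.
have [jN|Nj] := ltnP j N.
  apply: Or32; rewrite e1 ler_wpM2r// ler_wpM2l// (e s1) ?gt_eqF//.
  rewrite ler_wpM2r ?exprn_ge0 ?(ltW s1_0)//.
  by rewrite ler_weXn2l ?(ltnW jN)// ler_pdivlMr// mul1r ltW.
have [jn|nj] := leqP j n.
  apply: Or31; rewrite mulr1 mulrC ler_wpM2r ?und//.
  by rewrite mulr_ge0 ?exprn_ge0// ltW.
apply: Or33; rewrite e2 ler_wpM2r// ler_wpM2l// (e s2) ?gt_eqF//.
rewrite ler_wpM2r ?exprn_ge0 ?(ltW s20)//.
rewrite ler_wiXn2l ?(ltnW nj)//; first by rewrite divr_ge0// ltW.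
by rewrite ler_pdivrMr// mul1r ltW.
Qed.

End geometric_tails.

(** * Laplace exponents under the moderate deviation scaling *)

Section log_laplace.
Context (R : realType).

Context (f : R -> R) (b C : R) (b01 : 0 < b < 1) (C0 : 0 < C).
Hypothesis f_asymp : (1 - f s) / (1 - s) `^ b @[s --> 1^'-] --> C.
Context (cn : nat -> R) (cn_gt0 : forall n, 0 < cn n).
Hypothesis cn_infty : cn n @[n --> \oo] --> +oo.
Hypothesis cn_o : cn =o_\oo (fun n => n%:R : R).
Context (x : R) (x0 : 0 < x).

Definition rate_scale n : R := cn n / n%:R.
Local Notation lam := rate_scale.

Definition record_threshold n : nat :=
  `|Num.ceil (x * n%:R `^ b * cn n `^ (1 - b))|%N.

Lemma rate_scale_gt0 n : (0 < n)%N -> 0 < lam n.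
Proof. by move=> n0; rewrite divr_gt0// ltr0n. Qed.

Lemma cvg_rate_scale : lam n @[n --> \oo] --> (0 : R).
Proof.
move: cn_o => /eqoP cno; apply/cvgr0Pnorm_le => e e0.
near=> n.
have n0 : (0 < n)%N by near: n; exact: nbhs_infty_gt.
have : `|cn n| <= e * `|n%:R : R| by near: n; exact: cno.
rewrite /lam normrM normfV => h.
by rewrite ler_pdivrMr// normr_gt0 pnatr_eq0 -lt0n.
Unshelve. all: end_near. Qed.

Lemma cvg_exp_rate_scale (t : R) : 0 < t ->
  expR (- (t * lam n)) @[n --> \oo] --> 1^'-.
Proof.
move=> t0; apply: cvg_to_at_left.
  rewrite -expR0; apply: continuous_cvg; first exact: continuous_expR.
  rewrite -oppr0 -(mulr0 t); apply: cvgN; apply: cvgMr; exact: cvg_rate_scale.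
near=> n; rewrite expR_lt1 oppr_lt0 mulr_gt0 ?rate_scale_gt0//.
by near: n; exact: nbhs_infty_gt.
Unshelve. all: end_near. Qed.

Lemma cvg_record_threshold :
  (record_threshold n)%:R * lam n `^ b / cn n @[n --> \oo] --> x.
Proof.
have /andP[b0 b1] := b01.
have lamb0 : lam n `^ b @[n --> \oo] --> (0 : R).
  apply: (@cvg_comp _ _ _ lam (fun t => t `^ b) _ _ _ _ (powR_cvg0 b0)).
  apply: cvg_to_at_right; first exact: cvg_rate_scale.
  by near=> n; apply: rate_scale_gt0; near: n; exact: nbhs_infty_gt.
have cV : (cn n)^-1 @[n --> \oo] --> (0 : R).
  by apply: (gtr0_cvgV0 _).2 cn_infty; exact: nearW.
have up : x + lam n `^ b / cn n @[n --> \oo] --> x.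
  rewrite -[X in _ --> X]addr0 -[X in _ + X](mulr0 0).
  by apply: cvgD; [exact: cvg_cst|exact: cvgM].
apply: (squeeze_cvgr _ (cvg_cst x) up).
near=> n.
have n0 : 0 < n%:R :> R by rewrite ltr0n; near: n; exact: nbhs_infty_gt.
have c0 := cn_gt0 n.
set r := x * n%:R `^ b * cn n `^ (1 - b).
have r0 : 0 <= r by rewrite !mulr_ge0 ?powR_ge0// ltW.
have kE : (record_threshold n)%:R = (Num.ceil r)%:~R :> R.
  rewrite /record_threshold -/r -[RHS]ger0_norm ?ler0z ?ceil_ge0 //.
    by rewrite -intr_norm -abszE.
  by rewrite (lt_le_trans _ r0)// ltrN10.
have rk : r <= (record_threshold n)%:R by rewrite kE ceil_ge.
have kr : (record_threshold n)%:R <= r + 1.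
  by have := ltW (ceilB1_lt r); rewrite kE intrB lerBlDr.
have rE : r * lam n `^ b / cn n = x.
  have e : n%:R `^ b * lam n `^ b = cn n `^ b.
    by rewrite -powRM ?(ltW n0) ?divr_ge0 ?(ltW n0) ?(ltW c0)// mulrC divfK// gt_eqF.
  have -> : r * lam n `^ b / cn n =
      x * ((n%:R `^ b * lam n `^ b) * cn n `^ (1 - b)) / cn n by rewrite /r; ring.
  rewrite e -powRD; last by rewrite (gt_eqF c0) implybT.
  by rewrite addrC subrK powRr1 ?(ltW c0)// mulfK// gt_eqF.
have p0 : 0 <= lam n `^ b / cn n by rewrite divr_ge0 ?powR_ge0// ltW.
rewrite -mulrA in rE; rewrite -[X in _ <= X <= _]mulrA; apply/andP; split.
  by rewrite -[leLHS]rE ler_wpM2r.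
by rewrite -[X in X + _]rE -[X in _ + X]mul1r -mulrDl ler_wpM2r.
Unshelve. all: end_near. Qed.

(** With lam = c_n / n and s = exp(- t lam), the expression is the product
    of k lam^b / c_n -> x, (1 - f(s)) / (1 - s)^b -> C, ((1 - s) / lam)^b -> t^b
    and ln f(s) / (1 - f(s)) -> -1. *)
Lemma cvg_log_laplace (t : R) : 0 < t ->
  (record_threshold n)%:R / cn n * ln (f (expR (- (t * lam n))))
    @[n --> \oo] --> - (x * C * t `^ b).
Proof.
move=> t0; have /andP[b0 b1] := b01.
pose s n := expR (- (t * lam n)).
have sl : s n @[n --> \oo] --> 1^'- by exact: cvg_exp_rate_scale.
have s1 : s n @[n --> \oo] --> (1 : R).
  exact: (cvg_trans sl (cvg_within _)).
have L1 : (1 - f (s n)) / (1 - s n) `^ b @[n --> \oo] --> C.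
  exact: (cvg_comp _ _ sl f_asymp).
have L2 : (1 - s n) / lam n @[n --> \oo] --> t.
  have ts : t * s n @[n --> \oo] --> t.
    by rewrite -[X in _ --> X]mulr1; apply: cvgMr.
  apply: (squeeze_cvgr _ ts (cvg_cst t)).
  near=> n.
  have l0 : 0 < lam n by apply: rate_scale_gt0; near: n; exact: nbhs_infty_gt.
  rewrite ler_pdivrMr// ler_pdivlMr// mulrAC.
  exact: oneBexpRN_bounds.
have L2b : ((1 - s n) / lam n) `^ b @[n --> \oo] --> t `^ b by exact: cvg_powR.
have lamb0 : lam n `^ b @[n --> \oo] --> (0 : R).
  apply: (@cvg_comp _ _ _ lam (fun t => t `^ b) _ _ _ _ (powR_cvg0 b0)).
  apply: cvg_to_at_right; first exact: cvg_rate_scale.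
  by near=> n; apply: rate_scale_gt0; near: n; exact: nbhs_infty_gt.
have pE : \forall n \near \oo,
    [/\ 0 < (1 - s n) `^ b, 0 < lam n `^ b &
     ((1 - s n) / lam n) `^ b = (1 - s n) `^ b / lam n `^ b].
  near=> n.
  have l0 : 0 < lam n by apply: rate_scale_gt0; near: n; exact: nbhs_infty_gt.
  have sn1 : 0 < 1 - s n.
    by rewrite subr_gt0 expR_lt1 oppr_lt0 mulr_gt0.
  split; rewrite ?powR_gt0//.
  rewrite powRM ?invr_ge0 ?(ltW sn1) ?(ltW l0)//; congr (_ * _).
  by rewrite -powRN -mulN1r powRrM powR_inv1// ltW.
have fE : \forall n \near \oo, 1 - f (s n) =
    (1 - f (s n)) / (1 - s n) `^ b * ((1 - s n) / lam n) `^ b * lam n `^ b.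
  near=> n.
  have [p1 p2 ->] : [/\ 0 < (1 - s n) `^ b, 0 < lam n `^ b &
     ((1 - s n) / lam n) `^ b = (1 - s n) `^ b / lam n `^ b].
    by near: n.
  by field; rewrite !gt_eqF.
have f0 : 1 - f (s n) @[n --> \oo] --> (0 : R).
  rewrite -[X in _ --> X](mulr0 (C * t `^ b)).
  refine (cvg_near_eq _ (cvgM (cvgM L1 L2b) lamb0)).
  by apply: filterS fE => n /esym.
have f1 : f (s n) @[n --> \oo] --> (1 : R).
  rewrite (_ : (fun n => f (s n)) = (fun n => 1 - (1 - f (s n)))).
    by rewrite -[X in _ --> X]subr0; apply: cvgB => //; exact: cvg_cst.
  by apply/funext => n; rewrite subKr.
have flt : \forall n \near \oo, f (s n) < 1.
  near=> n.
  have g0 : 0 < (1 - f (s n)) / (1 - s n) `^ b.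
    by near: n; apply: (cvgr_gt C).
  have [p1 _ _] : [/\ 0 < (1 - s n) `^ b, 0 < lam n `^ b &
     ((1 - s n) / lam n) `^ b = (1 - s n) `^ b / lam n `^ b].
    by near: n.
  by move: g0; rewrite pmulr_lgt0 ?invr_gt0// subr_gt0.
have L3 : ln (f (s n)) / (1 - f (s n)) @[n --> \oo] --> (-1 : R).
  exact: cvg_ln_slope.
have -> : - (x * C * t `^ b) = x * t `^ b * C * -1 by ring.
refine (cvg_near_eq _ (cvgM (cvgM (cvgM cvg_record_threshold L2b) L1) L3)).
near=> n.
have [p1 p2 e] : [/\ 0 < (1 - s n) `^ b, 0 < lam n `^ b &
     ((1 - s n) / lam n) `^ b = (1 - s n) `^ b / lam n `^ b].
  by near: n.
have fl : f (s n) < 1 by near: n.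
rewrite /= -/(s n) e; field.
by rewrite !gt_eqF// subr_gt0.
Unshelve. all: end_near. Qed.

End log_laplace.

(** * Lower-tail moderate deviations *)

Section tilting_parameters.
Context (R : realType) (b : R) (b01 : 0 < b < 1).

Lemma powR_mean_value (y z : R) : 0 < y -> y < z ->
  exists2 xi, y < xi < z & (z `^ b - y `^ b) / b = xi `^ (b - 1) * (z - y).
Proof.
move=> y0 yz; have /andP[b0 _] := b01.
have [||xi] := @MVT R (fun t => t `^ b) (fun t => b * t `^ (b - 1)) y z yz.
- move=> t; rewrite in_itv/= => /andP[yt _].
  by apply: is_derive1_powR; exact: lt_trans yt.
- apply: derivable_within_continuous => t; rewrite in_itv/= => /andP[yt _].
  by apply: derivable_powR; rewrite in_itv/= andbT (lt_le_trans y0).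
rewrite in_itv/= => xi_in ->; exists xi => //.
by field; rewrite gt_eqF.
Qed.

Lemma powRB1_anti (y z : R) : 0 < y -> y < z -> z `^ (b - 1) < y `^ (b - 1).
Proof.
move=> y0 yz; have /andP[_ b1] := b01; have z0 := lt_trans y0 yz.
rewrite -(opprB 1 b) !powRN ltf_pV2 ?posrE ?powR_gt0//.
by rewrite gt0_ltr_powR ?nnegrE ?subr_gt0// ltW.
Qed.

Context (K : R) (K0 : 0 < K).

(** The maximiser over th of K th^b - th, where K th^b is the limiting
    Laplace exponent. *)
Definition critical_tilt : R := (K * b) `^ (1 - b)^-1.
Local Notation th0 := critical_tilt.

Lemma critical_tilt_gt0 : 0 < th0.
Proof. by have /andP[b0 _] := b01; rewrite powR_gt0// mulr_gt0. Qed.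

Lemma critical_tiltE t : 0 <= t -> K * (t * th0) `^ b = th0 * (t `^ b / b).
Proof.
move=> t0; have /andP[b0 b1] := b01; have th_gt0 := critical_tilt_gt0.
have h : K * b = th0 `^ (1 - b).
  by rewrite -powRrM mulVf ?subr_eq0 ?gt_eqF// powRr1// mulr_ge0// ltW.
have h2 : K * b * th0 `^ b = th0.
  rewrite h -powRD; last by rewrite (gt_eqF th_gt0) implybT.
  by rewrite subrK powRr1// ltW.
rewrite powRM ?(ltW th_gt0)// -{2}h2; field.
by rewrite gt_eqF.
Qed.

(** Take th slightly above the critical tilt. The slope of K th^b there is
    slightly below 1; rho is chosen below that slope. The first two
    conclusions say that mass beyond n and mass before rho n are negligible
    after tilting, the third that the resulting bound is almost optimal. *)
Lemma tilting_parameters (e : R) : 0 < e ->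
  exists th de rho : R,
  [/\ 0 < de, 2 * de <= th & 0 < rho < 1] /\
  [/\ - de - K * (th - de) `^ b < - (K * th `^ b),
      de * rho - K * (th + de) `^ b < - (K * th `^ b) &
      - (th0 * ((1 - b) / b)) - e <= th * rho - K * th `^ b].
Proof.
move=> e0; have /andP[b0 b1] := b01; have th_gt0 := critical_tilt_gt0.
have lim1 : t * (2 * t - 1) `^ (b - 1) - t `^ b / b @[t --> 1^'+] -->
    (1 * 1 `^ (b - 1) - 1 `^ b / b : R).
  have t1 : (fun t : R => t) t @[t --> 1^'+] --> (1 : R) by exact: cvg_within.
  apply: cvgB; first apply: cvgM => //.
    apply: cvg_powR => //; rewrite -[X in _ --> X](addrK 1 1).
    apply: cvgB; last exact: cvg_cst.
    by rewrite -[X in _ --> X](mulr1 2); apply: cvgMr.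
  by apply: cvgMl; exact: cvg_powR.
have : \forall t \near (1 : R)^'+, 1 - b^-1 - e / th0 <=
    t * (2 * t - 1) `^ (b - 1) - t `^ b / b.
  apply: (cvgr_ge (1 * 1 `^ (b - 1) - 1 `^ b / b)) => //.
  by rewrite !powR1 !mul1r ltrBlDr ltrDl divr_gt0.
move=> near1.
have [t [t1 tP]] : exists t : R, 1 < t /\ 1 - b^-1 - e / th0 <=
    t * (2 * t - 1) `^ (b - 1) - t `^ b / b.
  near ((1 : R)^'+) => t; exists t; split; first by near: t; exact: nbhs_right_gt.
  by near: t.
(* The shift d keeps both t - d > 1 and t + d < 2 t - 1. *)
pose d := (t - 1) / 2.
have d0 : 0 < d by rewrite divr_gt0// subr_gt0.
have td1 : 1 < t - d by rewrite /d; lra.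
have t0 : 0 < t by lra.
exists (t * th0), (d * th0), ((2 * t - 1) `^ (b - 1)); split.
  split; first by rewrite mulr_gt0.
    by rewrite mulrA ler_wpM2r ?(ltW th_gt0)// /d; lra.
  rewrite powR_gt0 ?andTb; last lra.
  by rewrite -[X in _ < X](congr1 (fun f => f (b - 1)) (@powR1 R)) powRB1_anti//; lra.
rewrite -mulrBl -mulrDl !critical_tiltE ?(ltW t0)//; [|lra..].
have [||x1 /andP[x1l x1r] x1E] := @powR_mean_value (t - d) t; [lra..|].
have [||x2 /andP[x2l x2r] x2E] := @powR_mean_value t (t + d); [lra..|].
have x1p : x1 `^ (b - 1) < 1.
  rewrite -[X in _ < X](congr1 (fun f => f (b - 1)) (@powR1 R)).
  by rewrite powRB1_anti//; lra.
have x2p : (2 * t - 1) `^ (b - 1) < x2 `^ (b - 1).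
  by rewrite powRB1_anti//; first lra; apply: lt_trans x2r _; rewrite /d; lra.
rewrite mulrBl subKr in x1E; rewrite mulrBl addrAC subrr add0r in x2E.
split.
- rewrite -subr_gt0 [X in 0 < X](_ : _ = th0 * (d * (1 - x1 `^ (b - 1)))).
    by rewrite !mulr_gt0// subr_gt0.
  by rewrite mulrBr mulr1 (mulrC d (x1 `^ _)) -x1E; ring.
- rewrite -subr_gt0 [X in 0 < X](_ : _ =
      th0 * (d * (x2 `^ (b - 1) - (2 * t - 1) `^ (b - 1)))).
    by rewrite !mulr_gt0// subr_gt0.
  by rewrite mulrBr (mulrC d (x2 `^ _)) -x2E; ring.
- have := ler_wpM2l (ltW th_gt0) tP.
  have -> : th0 * (1 - b^-1 - e / th0) = - (th0 * ((1 - b) / b)) - e.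
    by field; rewrite !gt_eqF.
  by move=> /le_trans; apply; rewrite le_eqVlt; apply/orP; left; apply/eqP; ring.
Unshelve. all: end_near. Qed.

End tilting_parameters.

Section large_deviations.
Context (R : realType).

Lemma cvg_lne_scaled (cn : nat -> R) (v : nat -> R) (L : R) :
  (forall n, 0 < cn n) ->
  (forall e : R, 0 < e -> \forall n \near \oo, expR (cn n * (L - e)) <= v n) ->
  (forall e : R, 0 < e -> \forall n \near \oo, v n <= expR (cn n * (L + e))) ->
  (((cn n)^-1)%:E * lne (v n)%:E)%E @[n --> \oo] --> L%:E.
Proof.
move=> cn0 lo up.
have v0 : \forall n \near \oo, 0 < v n.
  by apply: filterS (lo 1 ltr01) => n; apply: lt_le_trans; exact: expR_gt0.
have h : (cn n)^-1 * ln (v n) @[n --> \oo] --> L.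
  apply/cvgrPdist_le => e e0; near=> n.
  have c0 := cn0 n.
  have vn0 : 0 < v n by near: n.
  have lon : expR (cn n * (L - e)) <= v n by near: n; exact: lo.
  have upn : v n <= expR (cn n * (L + e)) by near: n; exact: up.
  rewrite -ler_ln ?posrE ?expR_gt0// expRK in lon.
  rewrite -ler_ln ?posrE ?expR_gt0// expRK in upn.
  have lo' : L - e <= (cn n)^-1 * ln (v n) by rewrite ler_pdivlMl.
  have up' : (cn n)^-1 * ln (v n) <= L + e by rewrite ler_pdivrMl.
  by rewrite ler_norml; apply/andP; split; lra.
suff : ((cn n)^-1 * ln (v n))%:E @[n --> \oo] --> L%:E.
  move=> h' P /h' Ph; apply: filterS2 v0 Ph => n vn0 /=.
  by rewrite leNgt vn0.
by apply: cvg_EFin => //; exact: nearW.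
Unshelve. all: end_near. Qed.

Context (f : R -> R) (b C : R) (b01 : 0 < b < 1) (C0 : 0 < C).
Hypothesis f_asymp : (1 - f s) / (1 - s) `^ b @[s --> 1^'-] --> C.
Hypothesis f_gt0 : forall s, 0 < s < 1 -> 0 < f s.
Context (u : nat -> nat -> R).
Hypothesis u0 : forall k n, 0 <= u k n.
Hypothesis u_nd : forall k, {homo u k : m n / (m <= n)%N >-> m <= n}.
Hypothesis u_gf : forall k s, 0 < s < 1 ->
  mean (geom s) (EFin \o u k) = (f s ^+ k)%:E.
Context (cn : nat -> R) (cn_gt0 : forall n, 0 < cn n).
Hypothesis cn_infty : cn n @[n --> \oo] --> +oo.
Hypothesis cn_o : cn =o_\oo (fun n => n%:R : R).
Context (x : R) (x0 : 0 < x).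

Local Notation lam := (rate_scale cn).
Local Notation kn := (record_threshold b cn x).
Let K := x * C.
Let K0 : 0 < K. Proof. by rewrite mulr_gt0. Qed.
Local Notation th0 := (critical_tilt b K).
Let e th n := expR (- (th * lam n)).
Let ell th n := (kn n)%:R / cn n * ln (f (e th n)).

Let e_in th n : 0 < th -> (0 < n)%N -> 0 < e th n < 1.
Proof.
move=> t0 n0; rewrite expR_gt0 expR_lt1 oppr_lt0 mulr_gt0//.
exact: rate_scale_gt0.
Qed.

Let f_pow th n : 0 < th -> (0 < n)%N ->
  f (e th n) ^+ kn n = expR (cn n * ell th n).
Proof.
move=> t0 n0; rewrite /ell mulrA [cn n * _]mulrC divfK ?gt_eqF//.
by rewrite expRM_natl lnK// posrE f_gt0// e_in.
Qed.

Let ell_le th eta : 0 < th -> 0 < eta ->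
  \forall n \near \oo, ell th n <= - (K * th `^ b) + eta.
Proof.
move=> t0 eta0; apply: (cvgr_le (- (K * th `^ b))); last by rewrite ltrDl.
exact: cvg_log_laplace.
Qed.

Let ell_ge th eta : 0 < th -> 0 < eta ->
  \forall n \near \oo, - (K * th `^ b) - eta <= ell th n.
Proof.
move=> t0 eta0; apply: (cvgr_ge (- (K * th `^ b))); last by rewrite gtrBl.
exact: cvg_log_laplace.
Qed.

Let lamn n : (0 < n)%N -> lam n * n%:R = cn n.
Proof. by move=> n0; rewrite divfK// pnatr_eq0 -lt0n. Qed.

(** Markov's inequality at the critical tilt. *)
Lemma record_tail_upper (eps : R) : 0 < eps ->
  \forall n \near \oo,
    u (kn n) n <= expR (cn n * (- (th0 * ((1 - b) / b)) + eps)).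
Proof.
move=> eps0; have th_gt0 := critical_tilt_gt0 b01 K0; near=> n.
have n0 : (0 < n)%N by near: n; exact: nbhs_infty_gt.
have le : ell th0 n <= - (K * th0 `^ b) + eps by near: n; exact: ell_le.
have sin := e_in th_gt0 n0; have /andP[s0 s1] := sin.
have sin' : 0 <= e th0 n < 1 by rewrite ltW.
have := geom_mean_ge n sin' (u0 (kn n)) (@u_nd (kn n)) (u_gf _ sin).
rewrite f_pow// /e -expRM_natr mulNr -mulrA lamn// expRN.
rewrite ler_pdivrMr ?expR_gt0// -expRD => /le_trans; apply.
rewrite ler_expR (mulrC th0) -mulrDr ler_wpM2l// ?(ltW (cn_gt0 n))//.
have := @critical_tiltE _ _ b01 _ K0 1 ler01; rewrite mul1r powR1 mul1r => E.
have /andP[b0 b1] := b01.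
have {E} : K * th0 `^ b = th0 + th0 * ((1 - b) / b).
  by rewrite E; field; rewrite gt_eqF.
by move: le; lra.
Unshelve. all: end_near. Qed.

(** With E = exp(c_n (L - 2 eta)), the three tilted averages compare as
    follows: the full one is at least 4 E, the early part at most E and the late
    part at most 2 E, so the part carried by [rho n, n] is at least E. *)
Lemma record_tail_lower (eps : R) : 0 < eps ->
  \forall n \near \oo,
    expR (cn n * (- (th0 * ((1 - b) / b)) - eps)) <= u (kn n) n.
Proof.
move=> eps0.
have eps20 : 0 < eps / 2 by rewrite divr_gt0.
have [th [de [rho [[de0 de2 /andP[rho0 rho1]] [g1 g2 g3]]]]] :=
  tilting_parameters b01 K0 eps20.
have th_gt0 : 0 < th by lra.
have thde : 0 < th - de by lra.
have thde' : 0 < th + de by lra.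
set L := - (K * th `^ b) in g1 g2.
(* A quarter of each gap, so that with an error eta on every exponent the main
   term still exceeds the other two by a factor exp(eta c_n). *)
pose eta := Num.min (eps / 4) (Num.min ((L - (- de - K * (th - de) `^ b)) / 4)
  ((L - (de * rho - K * (th + de) `^ b)) / 4)).
have eta0 : 0 < eta.
  by rewrite !lt_min !divr_gt0 ?subr_gt0.
have eta1 : eta <= eps / 4 by rewrite /eta ge_min lexx.
have eta2 : eta <= (L - (- de - K * (th - de) `^ b)) / 4.
  by rewrite /eta !ge_min lexx orbT.
have eta3 : eta <= (L - (de * rho - K * (th + de) `^ b)) / 4.
  by rewrite /eta !ge_min lexx !orbT.
near=> n.
have n0 : (0 < n)%N by near: n; exact: nbhs_infty_gt.
have c0 := cn_gt0 n.
have lam0 : 0 < lam n by exact: rate_scale_gt0.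
have l1 : L - eta <= ell th n by near: n; exact: ell_ge.
have l2 : ell (th - de) n <= - (K * (th - de) `^ b) + eta.
  by near: n; exact: ell_le.
have l3 : ell (th + de) n <= - (K * (th + de) `^ b) + eta.
  by near: n; exact: ell_le.
have c3 : 3 / eta <= cn n.
  by near: n; move/cvgryPge : cn_infty; apply.
have lam1 : lam n <= de^-1.
  by near: n; apply: (cvgr_le (0 : R)); [exact: cvg_rate_scale|rewrite invr_gt0].
have ec3 : 3 <= cn n * eta by rewrite -ler_pdivrMr.
have dlam : de * lam n <= cn n * eta.
  apply: (@le_trans _ _ 1); last lra.
  by rewrite mulrC -ler_pdivlMr// mul1r.
pose N := `|Num.ceil (rho * n%:R)|%N.
have nR0 : 0 < n%:R :> R by rewrite ltr0n.
have r0 : 0 <= rho * n%:R by rewrite mulr_ge0// ltW.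
have NE : N%:R = (Num.ceil (rho * n%:R))%:~R :> R.
  rewrite /N -[RHS]ger0_norm ?ler0z ?ceil_ge0 //.
    by rewrite -intr_norm -abszE.
  by rewrite (lt_le_trans _ r0)// ltrN10.
have Nge : rho * n%:R <= N%:R by rewrite NE ceil_ge.
have Nle : N%:R <= rho * n%:R + 1.
  by have := ltW (ceilB1_lt (rho * n%:R)); rewrite NE intrB lerBlDr.
have Nn : (N <= n)%N.
  have : N%:R < n%:R + 1 :> R.
    apply: le_lt_trans Nle _; rewrite ltrD2r.
    by rewrite -[X in _ < X]mul1r ltr_pM2r.
  by rewrite natr1 ltr_nat ltnS.
have lamN : rho * cn n <= lam n * N%:R.
  by rewrite -(lamn n0) mulrCA ler_wpM2l// ltW.
have lamN' : lam n * N%:R <= rho * cn n + lam n.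
  rewrite -(lamn n0) mulrCA -[X in _ <= _ + X]mulr1 -mulrDr ler_wpM2l//.
  exact: ltW.
have s_in := e_in th_gt0 n0; have s1_in := e_in thde' n0.
have s2_in := e_in thde n0.
have s1s : e (th + de) n < e th n.
  by rewrite ltr_expR ltrN2 ltr_pM2r// ltrDl.
have ss2 : e th n < e (th - de) n.
  by rewrite ltr_expR ltrN2 ltr_pM2r// gtrBl.
have s2_1 : e (th - de) n < 1 by case/andP: s2_in.
have s1_0 : 0 < e (th + de) n by case/andP: s1_in.
have := geom_mean_le Nn s1_0 s1s ss2 s2_1 (u0 (kn n)) (@u_nd (kn n))
  (u_gf _ s_in) (u_gf _ s1_in) (u_gf _ s2_in).
rewrite !f_pow// -!expRB -!expRM_natr.
set E := expR (cn n * (L - 2 * eta)).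
have E0 : 0 < E by exact: expR_gt0.
have A_ge : 4 * E <= expR (cn n * ell th n).
  apply: (@le_trans _ _ (expR (cn n * (L - eta)))); last first.
    by rewrite ler_expR ler_wpM2l// ltW.
  have -> : cn n * (L - eta) = cn n * eta + cn n * (L - 2 * eta) by ring.
  rewrite expRD ler_wpM2r ?(ltW E0)//.
  by apply: le_trans (expR_ge1Dx _); lra.
(* The times before N: the exponent is off by 2 eta out of a gap of 4 eta. *)
have T2 : (1 - e th n) / (1 - e (th + de) n) *
    expR ((- (th * lam n) - - ((th + de) * lam n)) * N%:R) *
    expR (cn n * ell (th + de) n) <= E.
  rewrite -mulrA -[leRHS]mul1r; apply: ler_pM.
  - by rewrite divr_ge0// subr_ge0 ltW//; [case/andP: s_in|case/andP: s1_in].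
  - by rewrite mulr_ge0 ?expR_ge0.
  - have ? : e (th + de) n < 1 by case/andP: s1_in.
    by rewrite ler_pdivrMr ?subr_gt0// mul1r lerD2l lerN2 ltW.
  - rewrite -expRD ler_expR.
    have -> : (- (th * lam n) - - ((th + de) * lam n)) * N%:R =
        de * (lam n * N%:R) by ring.
    have h1 : de * (lam n * N%:R) <= de * (rho * cn n + lam n).
      by rewrite ler_wpM2l// ltW.
    have h2 : cn n * ell (th + de) n <= cn n * (- (K * (th + de) `^ b) + eta).
      by rewrite ler_wpM2l// ltW.
    have h3 : cn n * (de * rho - K * (th + de) `^ b + 4 * eta) <= cn n * L.
      by rewrite ler_wpM2l ?(ltW c0)//; lra.
    by move: h1 h2 h3 dlam; rewrite !(mulrDr, mulrBr); lra.
(* The times after n: the factor 2 comes from 2 de <= th, that is, from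
   s >= s2 ^ 2 for the parameters s of th and s2 of th - de. *)
have T3 : (1 - e th n) / (1 - e (th - de) n) *
    expR ((- (th * lam n) - - ((th - de) * lam n)) * n%:R) *
    expR (cn n * ell (th - de) n) <= 2 * E.
  rewrite -mulrA; apply: ler_pM.
  - by rewrite divr_ge0// subr_ge0 ltW//; case/andP: s_in.
  - by rewrite mulr_ge0 ?expR_ge0.
  - rewrite ler_pdivrMr ?subr_gt0//.
    have sq : e (th - de) n * e (th - de) n <= e th n.
      rewrite -expRD ler_expR.
      have := ler_wpM2r (ltW lam0) de2; lra.
    have : 0 < e (th - de) n by case/andP: s2_in.
    set z := e (th - de) n in s2_1 sq *; nra.
  - rewrite -expRD ler_expR.
    have -> : (- (th * lam n) - - ((th - de) * lam n)) * n%:R =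
        - (de * (lam n * n%:R)) by ring.
    rewrite lamn//.
    have h2 : cn n * ell (th - de) n <= cn n * (- (K * (th - de) `^ b) + eta).
      by rewrite ler_wpM2l// ltW.
    have h3 : cn n * (- de - K * (th - de) `^ b + 4 * eta) <= cn n * L.
      by rewrite ler_wpM2l ?(ltW c0)//; lra.
    by move: h2 h3 ec3; rewrite !(mulrDr, mulrBr, mulrN); lra.
move=> main.
have uE : E <= u (kn n) n * expR (- (th * lam n) * N%:R).
  by move: main A_ge T2 T3; lra.
have uE' : E <= u (kn n) n * expR (- (cn n * (th * rho))).
  apply: le_trans uE _; rewrite ler_wpM2l// ler_expR mulNr lerN2.
  by rewrite -mulrA mulrCA ler_wpM2l ?(ltW th_gt0)// mulrC.
rewrite expRN ler_pdivlMr ?expR_gt0// -expRD in uE'.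
apply: le_trans uE'; rewrite ler_expR -mulrDr ler_wpM2l ?(ltW c0)//.
by move: g3; rewrite -/L; lra.
Unshelve. all: end_near. Qed.

Lemma record_tail_ldp :
  (((cn n)^-1)%:E * lne (u (kn n) n)%:E)%E @[n --> \oo] -->
    (- (critical_tilt b (x * C) * ((1 - b) / b)))%:E.
Proof.
by apply: cvg_lne_scaled => // [|] eps eps0;
  [exact: record_tail_lower|exact: record_tail_upper].
Qed.

End large_deviations.

(** * The two walks *)

Section assembly.
Context (d : measure_display) (T : measurableType d) (R : realType).
Context (P : probability T R) (X : nat -> {RV P >-> int}).
Hypothesis indep : mutually_independent X.

(** The two walks differ by the chain of depths and by the exponent b
    and constant C of f only. *)
Lemma record_number_ldp (w : nat -> R) (z : nat -> int)
    (step : nat -> nat -> option nat) (f : R -> R) (b C : R) (cn : nat -> R) :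
  is_weight w -> injective z ->
  (forall i j, P (X i @^-1` [set z j]) = (w j)%:E) ->
  (forall y j, if step y j is Some y'
    then (z j < y%:Z) /\ (y'%:Z = y%:Z - z j) else y%:Z <= z j) ->
  0 < b < 1 -> 0 < C ->
  (forall s, 0 < s < 1 -> record_gf w step s 1 0 = (f s)%:E) ->
  (forall s, 0 < s < 1 -> 0 < f s) ->
  (1 - f s) / (1 - s) `^ b @[s --> 1^'-] --> C ->
  (forall n, 0 < cn n) -> cn n @[n --> \oo] --> +oo ->
  cn =o_\oo (fun n => n%:R : R) ->
  forall x : R, 0 < x ->
  (((cn n)^-1)%:E *
     lne (P [set t | (x * n%:R `^ b * cn n `^ (1 - b)
                       <= weak_record_number R (walk X t) n)%R]))%E
    @[n --> \oo] -->
    (- (critical_tilt b (x * C) * ((1 - b) / b)))%:E.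
Proof.
move=> hw zi law stepP b01 C0 fE f0 fas cn0 cnoo cno x x0.
pose u k n := fine (record_prob w step n k 0).
have uE k n : (u k n)%:E = record_prob w step n k 0.
  by rewrite fineK// record_prob_fin.
rewrite (_ : (fun n => _) = (fun n => (((cn n)^-1)%:E *
    lne (u (record_threshold b cn x n) n)%:E)%E)); last first.
  apply/funext => n; congr (_ * lne _)%E.
  rewrite uE -(record_count_law indep hw zi law stepP); congr (P _).
  apply/funext => t; apply/propext => /=.
  have r0 : 0 <= x * n%:R `^ b * cn n `^ (1 - b).
    by rewrite !mulr_ge0 ?powR_ge0// ltW.
  by rewrite (weak_record_number_ge (X ^~ t) n r0).
apply: (record_tail_ldp b01 C0 fas f0) => //.
- by move=> k n; rewrite -lee_fin uE record_prob_ge0.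
- move=> k m n mn; rewrite -lee_fin !uE.
  exact: (record_prob_nd hw step k 0 mn).
- move=> k s s01; have s01' : 0 <= s < 1 by case/andP: s01 => s0 ->; rewrite ltW.
  rewrite (_ : EFin \o u k = (fun n => record_prob w step n k 0)).
    rewrite -/(record_gf w step s k 0) record_gf_pow// fE//.
  by apply/funext => n /=; rewrite uE.
Qed.

End assembly.

Section steps.

Definition right_increment (j : nat) : int := 1 - j%:Z.
Definition left_increment (j : nat) : int := j%:Z - 1.

Lemma right_increment_inj : injective right_increment.
Proof. by move=> i j; rewrite /right_increment; lia. Qed.

Lemma left_increment_inj : injective left_increment.
Proof. by move=> i j; rewrite /left_increment; lia. Qed.

Lemma right_stepP y j : if right_step y j is Some y'
  then (right_increment j < y%:Z) /\ (y'%:Z = y%:Z - right_increment j)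
  else y%:Z <= right_increment j.
Proof. by rewrite /right_step /right_increment; case: leqP => h /=; lia. Qed.

Lemma left_stepP y j : if left_step y j is Some y'
  then (left_increment j < y%:Z) /\ (y'%:Z = y%:Z - left_increment j)
  else y%:Z <= left_increment j.
Proof. by rewrite /left_step /left_increment; case: ltnP => h /=; lia. Qed.

End steps.

Section asymptotics.
Context (R : realType) (q : R) (p : nat -> R).
Hypotheses (hq : 0 < q) (hp : forall n, 0 <= p n).
Hypothesis hqp : (q%:E + \sum_(0 <= n <oo) (p n)%:E = 1)%E.
Hypothesis phi'1 : is_left_derivative (phi q p) 1 1.
Local Notation h := (minimal_solution q p).

Lemma root_mean (s : R) : 0 < s < 1 ->
  ((h s)%:E = s%:E * mean (offspring q p) (fun j => (h s ^+ j)%:E))%E.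
Proof.
move=> s01; have [/andP[h0 h1] hE] := minimal_solutionP hq hp hqp phi'1 s01.
by rewrite phi_mean// ?(ltW h0) ?(ltW h1)// -EFinM -hE.
Qed.

Definition right_gf (s : R) : R := 1 - s * q * (1 - h s) / h s.
Definition left_gf (s : R) : R := (s - h s) / (1 - h s).

Lemma right_gfE s : 0 < s < 1 ->
  record_gf (offspring q p) right_step s 1 0 = (right_gf s)%:E.
Proof.
move=> s01; have [h01 _] := minimal_solutionP hq hp hqp phi'1 s01.
by rewrite (right_first_record_gf (offspring_weight hq hp hqp) s01 h01 (root_mean s01)).
Qed.

Lemma left_gfE s : 0 < s < 1 ->
  record_gf (offspring q p) left_step s 1 0 = (left_gf s)%:E.
Proof.
move=> s01; have [h01 _] := minimal_solutionP hq hp hqp phi'1 s01.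
by rewrite (left_first_record_gf (offspring_weight hq hp hqp) s01 h01 (root_mean s01)).
Qed.

Lemma right_gf_gt0 s : 0 < s < 1 -> 0 < right_gf s.
Proof.
move=> s01; have [/andP[h0 h1] hE] := minimal_solutionP hq hp hqp phi'1 s01.
have /andP[s0 s1] := s01.
have sq : s * q <= h s.
  by rewrite [leRHS]hE ler_wpM2l ?(ltW s0)// phi_ge// !ltW.
rewrite /right_gf subr_gt0 ltr_pdivrMr// mul1r.
have := mulr_gt0 (mulr_gt0 s0 hq) h0; lra.
Qed.

Lemma left_gf_gt0 s : 0 < s < 1 -> 0 < left_gf s.
Proof.
move=> s01; have [/andP[h0 h1] hE] := minimal_solutionP hq hp hqp phi'1 s01.
have /andP[s0 s1] := s01.
rewrite divr_gt0 ?subr_gt0// [ltLHS]hE -[ltRHS]mulr1 ltr_pM2l//.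
by apply: phi_lt1 => //; rewrite h1 ltW.
Qed.

Context (a c : R) (a01 : 0 < a < 1) (c0 : 0 < c).
Hypothesis hlim : (1 - s * (phi q p)^`()%classic (h s)) / (1 - s) `^ a
            @[s --> 1^'-] --> c.

Let near01 : \forall s \near (1 : R)^'-, 0 < s < 1.
Proof.
near=> s; apply/andP; split; near: s; [exact: nbhs_left_gt|exact: nbhs_left_lt].
Unshelve. all: end_near. Qed.

Lemma right_gf_asymptotics :
  (1 - right_gf s) / (1 - s) `^ (1 - a) @[s --> 1^'-] --> q / (c * (1 - a)).
Proof.
have /andP[a0 a1] := a01.
have s1 : (fun s : R => s) s @[s --> 1^'-] --> (1 : R) by exact: cvg_within.
have h1 : h s @[s --> 1^'-] --> (1 : R).
  exact: (cvg_trans (cvg_minimal_solution hq hp hqp phi'1) (cvg_within _)).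
have main := cvg_root_asymptotics hq hp hqp phi'1 a01 hlim.
have l : s * q / h s * ((1 - s) `^ (1 - a) / (1 - h s))^-1 @[s --> 1^'-] -->
    1 * q / 1 * (c * (1 - a))^-1.
  apply: cvgM; first by apply: cvgM; [exact: cvgMl|exact: cvgV].
  by apply: cvgV => //; rewrite gt_eqF// mulr_gt0// subr_gt0.
rewrite mul1r divr1 in l.
apply: (cvg_near_eq _ l).
apply: filterS near01 => s s01.
have [/andP[h0 hl] hE] := minimal_solutionP hq hp hqp phi'1 s01.
have /andP[s0 sl] := s01.
have pow0 : 0 < (1 - s) `^ (1 - a) by rewrite powR_gt0 ?subr_gt0.
rewrite /right_gf; field.
by rewrite !gt_eqF ?subr_gt0.
Qed.

Lemma left_gf_asymptotics :
  (1 - left_gf s) / (1 - s) `^ a @[s --> 1^'-] --> c * (1 - a).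
Proof.
have /andP[a0 a1] := a01.
have main := cvg_root_asymptotics hq hp hqp phi'1 a01 hlim.
apply: (cvg_near_eq _ main).
apply: filterS near01 => s s01.
have [/andP[h0 hl] hE] := minimal_solutionP hq hp hqp phi'1 s01.
have /andP[s0 sl] := s01.
have pow0 : 0 < (1 - s) `^ a by rewrite powR_gt0 ?subr_gt0.
rewrite powRB ?subr_eq0 ?(gt_eqF sl) ?implybT// powRr1 ?subr_ge0 ?(ltW sl)//.
rewrite /left_gf; field.
by rewrite !gt_eqF ?subr_gt0.
Qed.

Lemma right_rateE (x : R) : 0 < x ->
  critical_tilt (1 - a) (x * (q / (c * (1 - a)))) * ((1 - (1 - a)) / (1 - a)) =
  a / (1 - a) * (q / c) `^ a^-1 * x `^ a^-1.
Proof.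
move=> x0; have /andP[a0 a1] := a01.
have b0 : 0 < 1 - a by rewrite subr_gt0.
rewrite /critical_tilt subKr.
have -> : x * (q / (c * (1 - a))) * (1 - a) = (q / c) * x.
  by field; rewrite !gt_eqF.
by rewrite powRM ?divr_ge0 ?ltW//; ring.
Qed.

Lemma left_rateE (x : R) : 0 < x ->
  critical_tilt a (x * (c * (1 - a))) * ((1 - a) / a) =
  (c * (1 - a) `^ (2 - a) * a `^ a) `^ (1 - a)^-1 * x `^ (1 - a)^-1.
Proof.
move=> x0; have /andP[a0 a1] := a01.
have b0 : 0 < 1 - a by rewrite subr_gt0.
rewrite /critical_tilt; set r := (1 - a)^-1.
have e1 : (2 - a) * r = 1 + r by rewrite /r; field; rewrite gt_eqF.
have e2 : a * r = r - 1 by rewrite /r; field; rewrite gt_eqF.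
rewrite !powRM ?mulr_ge0 ?powR_ge0 ?(ltW b0) ?(ltW x0) ?(ltW c0) ?(ltW a0)//.
rewrite -!powRrM e1 e2 powRD ?(gt_eqF b0) ?implybT//.
rewrite powRB ?(gt_eqF a0) ?implybT// !powRr1 ?(ltW b0) ?(ltW a0)//.
by ring.
Qed.

End asymptotics.

Theorem theorem2p2 (d : measure_display) (T : measurableType d) (R : realType)
  (P : probability T R) (X : nat -> {RV P >-> int}) (hX : iid X)
  (q : R) (p : nat -> R) (hq : 0 < q) (hp : forall n, 0 <= p n)
  (hqp : (q%:E + \sum_(0 <= n <oo) (p n)%:E = 1)%E)
  (hphi1 : is_left_derivative (phi q p) 1 1)
  (a c : R) (ha : 0 < a < 1) (hc : 0 < c)
  (hlim : (1 - s * (phi q p)^`()%classic (minimal_solution q p s)) / (1 - s) `^ a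
            @[s --> 1^'-] --> c)
  (cn : nat -> R) (hcn_gt0 : forall n, 0 < cn n)
  (hcn_infty : cn n @[n --> \oo] --> +oo)
  (hcn_o : cn =o_\oo (fun n => n%:R : R)) :
  (right_continuous_walk q p X ->
    forall x : R, 0 < x ->
    (((cn n)^-1)%:E *
       lne (P [set w | (x * n%:R `^ (1 - a) * cn n `^ a
                         <= weak_record_number R (walk X w) n)%R]))%E
      @[n --> \oo] -->
      (- (a / (1 - a) * (q / c) `^ a^-1 * x `^ a^-1))%:E)
  /\
  (left_continuous_walk q p X ->
    forall x : R, 0 < x ->
    (((cn n)^-1)%:E *
       lne (P [set w | (x * n%:R `^ a * cn n `^ (1 - a)
                         <= weak_record_number R (walk X w) n)%R]))%E
      @[n --> \oo] -->
      (- ((c * (1 - a) `^ (2 - a) * a `^ a) `^ (1 - a)^-1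
            * x `^ (1 - a)^-1))%:E).
Proof.
have [indep _] := hX; have /andP[a0 a1] := ha.
have hw := offspring_weight hq hp hqp.
split=> walkX x x0.
  have law i j : P (X i @^-1` [set right_increment j]) = (offspring q p j)%:E.
    case: j => [|n]; rewrite /right_increment /=.
      by rewrite subr0; have [] := walkX i.
    have -> : 1 - n.+1%:Z = - n%:Z by lia.
    by have [_] := walkX i.
  have b01 : 0 < 1 - a < 1 by rewrite subr_gt0 a1 gtrBl.
  have C0 : 0 < q / (c * (1 - a)) by rewrite divr_gt0// mulr_gt0// subr_gt0.
  have main := record_number_ldp indep hw right_increment_inj law right_stepP
    b01 C0 (right_gfE hq hp hqp hphi1) (right_gf_gt0 hq hp hqp hphi1)
    (right_gf_asymptotics hq hp hqp hphi1 ha hc hlim)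
    hcn_gt0 hcn_infty hcn_o x0.
  by rewrite right_rateE// subKr in main.
rewrite -(left_rateE ha hc x0).
apply: (record_number_ldp indep hw left_increment_inj _ left_stepP _ _
  (left_gfE hq hp hqp hphi1) (left_gf_gt0 hq hp hqp hphi1)
  (left_gf_asymptotics hq hp hqp hphi1 ha hlim)) => //.
- move=> i [|n]; rewrite /left_increment /=.
    by rewrite sub0r; have [] := walkX i.
  have -> : n.+1%:Z - 1 = n%:Z by lia.
  by have [_] := walkX i.
- by rewrite mulr_gt0// subr_gt0.
Qed.
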